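(* The OB unboundedness and OB termination problems are decidable for FIFO machines. That is, given a FIFO machine $M=(Q,\mathit{Ch},\Sigma,\Delta,q_0)$ and a tuple $(L_c)_{c\in\mathit{Ch}}$ of non-empty regular bounded languages $L_c\subseteq\Sigma_c^\ast$, it is decidable (i) whether $\mathrm{Reach}_M(\mathrm{Pref}(L_?))$ is infinite, and (ii) whether there is no infinite execution $s_0\xrightarrow{\beta_1}s_1\xrightarrow{\beta_2}s_2\cdots$ from the initial configuration $s_0$ with $\beta_i\in A_M$ and $\beta_1\cdots\beta_i\in\mathrm{Pref}(L_?)$ for all $i$.
   Context: A bounded language over non-empty words $(w_1,\ldots,w_n)$ is a language $L\subseteq w_1^\ast\cdots w_n^\ast$. A FIFO machine is $M=(Q,\mathit{Ch},\Sigma,\Delta,q_0)$ with finite control states $Q$, initial state $q_0$, finite channels $\mathit{Ch}$, alphabet $\Sigma=\biguplus_c\Sigma_c$, and $\Delta\subseteq Q\times A_M\times Q$, $A_M=\{c!a,c?a\mid c\in\mathit{Ch},a\in\Sigma_c\}$. Configurations $(q,\mathbf{w})$ with $\mathbf{w}\in\prod_c\Sigma_c^\ast$; initial $(q_0,(\varepsilon)_c)$. A send $c!a$ appends $a$ to channel $c$; a receive $c?a$ removes $a$ from the head of channel $c$ (only possible if $a$ is at the head); other channels unchanged; the control state moves along a transition of $\Delta$. $\mathrm{Reach}_M(L)$ is the set of configurations reachable from the initial one via a label word in $L\subseteq A_M^\ast$. $L_?=\{\sigma\in A_M^\ast\mid\mathrm{proj}_{c?}(\sigma)\in L_c\ \forall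 c\}$, where $\mathrm{proj}_{c?}$ keeps the messages of receive actions on $c$ and erases all other actions. $\mathrm{Pref}(L)$ is the set of prefixes of words in $L$. *)

(* Defs.v *)
From Stdlib Require Import List Arith.
Import ListNotations.

(* Decidability is expressed as existence of a register-machine        *)
(* program, so that classical axioms cannot trivialize it.            *)

Inductive instr : Type :=
| INC (r : nat)
| DEC (r : nat) (j : nat).

Definition rm_config : Type := (nat * (nat -> nat))%type.

Definition upd_reg (regs : nat -> nat) (r v : nat) : nat -> nat :=
  fun r' => if Nat.eqb r' r then v else regs r'.

Definition rm_step (p : list instr) (c : rm_config) : rm_config :=
  let (pc, regs) := c in
  match nth_error p pc with
  | None => c
  | Some (INC r) => (S pc, upd_reg regs r (S (regs r)))
  | Some (DEC r j) =>
      match regs r with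
      | 0 => (j, regs)
      | S v => (S pc, upd_reg regs r v)
      end
  end.

Fixpoint rm_run (p : list instr) (n : nat) (c : rm_config) : rm_config :=
  match n with
  | 0 => c
  | S n' => rm_run p n' (rm_step p c)
  end.

Definition rm_init (x : nat) : rm_config := (0, fun r => if Nat.eqb r 0 then x else 0).

Definition halts_with (p : list instr) (x y : nat) : Prop :=
  exists n, nth_error p (fst (rm_run p n (rm_init x))) = None /\
            snd (rm_run p n (rm_init x)) 0 = y.

Definition decidable_on {A : Type} (enc : A -> nat) (Dom P : A -> Prop) : Prop :=
  exists p : list instr, forall a, Dom a ->
    (halts_with p (enc a) 1 /\ P a) \/ (halts_with p (enc a) 0 /\ ~ P a).

Definition cpair (x y : nat) : nat := (x + y) * (x + y + 1) / 2 + y.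

Fixpoint enc_list (l : list nat) : nat :=
  match l with
  | [] => 0
  | x :: l' => S (cpair x (enc_list l'))
  end.

(* FIFO machines. States are 0..nstates-1, channels 0..nchan-1, the    *)
(* alphabet Sigma_c of channel c is {0..(nth c alph 0)-1}; the letters *)
(* of different channels are considered distinct (disjoint union).     *)

Inductive action : Type :=
| Send (c a : nat)
| Recv (c a : nat).

Record fifo : Type := {
  f_nstates : nat;
  f_init : nat;
  f_nchan : nat;
  f_alph : list nat;
  f_trans : list (nat * action * nat)
}.

Definition valid_action (M : fifo) (b : action) : Prop :=
  match b with
  | Send c a | Recv c a => c < f_nchan M /\ a < nth c (f_alph M) 0
  end.

Definition wf_fifo (M : fifo) : Prop :=
  f_init M < f_nstates M /\ length (f_alph M) = f_nchan M /\
  forall q b q', In (q, b, q') (f_trans M) ->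
    q < f_nstates M /\ q' < f_nstates M /\ valid_action M b.

Definition config : Type := (nat * list (list nat))%type.

Definition init_config (M : fifo) : config := (f_init M, repeat [] (f_nchan M)).

Definition upd_chan (w : list (list nat)) (c : nat) (x : list nat) : list (list nat) :=
  firstn c w ++ x :: skipn (S c) w.

Definition fifo_step (M : fifo) (s : config) (b : action) (s' : config) : Prop :=
  In (fst s, b, fst s') (f_trans M) /\
  match b with
  | Send c a => c < length (snd s) /\
                snd s' = upd_chan (snd s) c (nth c (snd s) [] ++ [a])
  | Recv c a => c < length (snd s) /\
                exists rest, nth c (snd s) [] = a :: rest /\
                snd s' = upd_chan (snd s) c rest
  end.

Inductive fifo_reach (M : fifo) : config -> list action -> config -> Prop :=
| fr_nil s : fifo_reach M s [] s
| fr_cons s b s1 sigma s2 :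
    fifo_step M s b s1 -> fifo_reach M s1 sigma s2 -> fifo_reach M s (b :: sigma) s2.

Record nfa : Type := {
  n_nstates : nat;
  n_init : list nat;
  n_final : list nat;
  n_trans : list (nat * nat * nat)
}.

Definition wf_nfa (k : nat) (A : nfa) : Prop :=
  (forall p, In p (n_init A) -> p < n_nstates A) /\
  (forall p, In p (n_final A) -> p < n_nstates A) /\
  (forall p a q, In (p, a, q) (n_trans A) -> p < n_nstates A /\ a < k /\ q < n_nstates A).

Inductive nfa_path (A : nfa) : nat -> list nat -> nat -> Prop :=
| np_nil p : nfa_path A p [] p
| np_cons p a q u r :
    In (p, a, q) (n_trans A) -> nfa_path A q u r -> nfa_path A p (a :: u) r.

Definition nfa_lang (A : nfa) (u : list nat) : Prop :=
  exists p q, In p (n_init A) /\ In q (n_final A) /\ nfa_path A p u q.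

Fixpoint in_bounded (ws : list (list nat)) (u : list nat) : Prop :=
  match ws with
  | [] => u = []
  | w :: ws' => exists n v, u = concat (repeat w n) ++ v /\ in_bounded ws' v
  end.

Definition bounded_lang (k : nat) (L : list nat -> Prop) : Prop :=
  exists ws : list (list nat),
    Forall (fun w => w <> [] /\ Forall (fun a => a < k) w) ws /\
    forall u, L u -> in_bounded ws u.

Record instance : Type := {
  i_fifo : fifo;
  i_langs : list nfa
}.

Definition lang_of (I : instance) (c : nat) : list nat -> Prop :=
  nfa_lang (nth c (i_langs I) {| n_nstates := 0; n_init := []; n_final := []; n_trans := [] |}).

Definition wf_instance (I : instance) : Prop :=
  wf_fifo (i_fifo I) /\ length (i_langs I) = f_nchan (i_fifo I) /\
  forall c, c < f_nchan (i_fifo I) ->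
    let k := nth c (f_alph (i_fifo I)) 0 in
    wf_nfa k (nth c (i_langs I) {| n_nstates := 0; n_init := []; n_final := []; n_trans := [] |}) /\
    (exists u, lang_of I c u) /\ bounded_lang k (lang_of I c).

Definition proj_recv (c : nat) (sigma : list action) : list nat :=
  flat_map (fun b => match b with
                     | Recv c' a => if Nat.eqb c' c then [a] else []
                     | Send _ _ => []
                     end) sigma.

Definition L_recv (I : instance) (sigma : list action) : Prop :=
  Forall (valid_action (i_fifo I)) sigma /\
  forall c, c < f_nchan (i_fifo I) -> lang_of I c (proj_recv c sigma).

Definition Pref (L : list action -> Prop) (sigma : list action) : Prop :=
  exists tau, L (sigma ++ tau).

Definition reach_set (I : instance) (s : config) : Prop :=
  exists sigma, Pref (L_recv I) sigma /\ fifo_reach (i_fifo I) (init_config (i_fifo I)) sigma s.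

Definition OB_unbounded (I : instance) : Prop :=
  ~ exists l : list config, forall s, reach_set I s -> In s l.

Definition OB_terminating (I : instance) : Prop :=
  ~ exists (s : nat -> config) (beta : nat -> action),
      s 0 = init_config (i_fifo I) /\
      forall i, fifo_step (i_fifo I) (s i) (beta i) (s (S i)) /\
                Pref (L_recv I) (map beta (seq 0 (S i))).

Definition enc_action (b : action) : nat :=
  match b with
  | Send c a => cpair 0 (cpair c a)
  | Recv c a => cpair 1 (cpair c a)
  end.

Definition enc_ftrans (t : nat * action * nat) : nat :=
  match t with (q, b, q') => cpair q (cpair (enc_action b) q') end.

Definition enc_fifo (M : fifo) : nat :=
  cpair (f_nstates M) (cpair (f_init M) (cpair (f_nchan M)
    (cpair (enc_list (f_alph M)) (enc_list (map enc_ftrans (f_trans M)))))).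

Definition enc_ntrans (t : nat * nat * nat) : nat :=
  match t with (p, a, q) => cpair p (cpair a q) end.

Definition enc_nfa (A : nfa) : nat :=
  cpair (n_nstates A) (cpair (enc_list (n_init A)) (cpair (enc_list (n_final A))
    (enc_list (map enc_ntrans (n_trans A))))).

Definition enc_instance (I : instance) : nat :=
  cpair (enc_fifo (i_fifo I)) (enc_list (map enc_nfa (i_langs I))).

(* Main.v *)
From Stdlib Require Import List Arith Lia FunctionalExtensionality FinFun.
From Stdlib Require Import Classical IndefiniteDescription.
Import ListNotations.
Require Import Defs.

(* Both problems and their complements are semidecidable, and a register machine can search
   for the two kinds of certificates in parallel.  Track in the state, besides the
   configuration, the set of states which the automaton of each channel may be in after the
   letters received so far.  If no finite set of states is closed under steps, there is an
   infinite run without repetition.  A channel with infinitely many receives on it then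
   receives an ultimately periodic word, since its language is bounded, and all that is sent
   on it is received; so positions modulo the period, together with Dickson's lemma on the
   channel lengths, yield two points of the run between which every channel content [w]
   grows to [w z], where [z] commutes with the word sent in between.  Such a loop can be
   repeated forever, each round appending [z] once more. *)

(** * Structured register programs *)

(** Commutation is what makes a loop repeatable. Suppose that one round turns a channel content [w]
    into [w z] while sending [u]. The next round works on [w z u] instead of [w u]; since
    [z u = u z], this is [w u z], so the same letters can be received and one more [z] is left
    behind.

    The sets of automaton states turn membership in [Pref] into a property of the current state
    alone. As a loop restores these sets, a continuation that is accepted before the loop is
    accepted after every number of rounds. A clock, frozen or ticking, lets one pair of certificates
    serve both problems.

    That one of the two certificates always exists is shown classically; the register machine merely
    searches and checks. *)

Inductive prog : Type :=
| PInc (r : nat)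
| PDec (r : nat)
| PSeq (p q : prog)
| PLoop (r : nat) (p : prog).

Infix ";;" := PSeq (at level 60, right associativity).

Notation upd := upd_reg.

(** Only terminating runs are described. This suffices, since an unbounded search is executed only
    where it is known to succeed. *)
Inductive exec : prog -> (nat -> nat) -> (nat -> nat) -> Prop :=
| ex_inc r e : exec (PInc r) e (upd e r (S (e r)))
| ex_dec r e : exec (PDec r) e (upd e r (pred (e r)))
| ex_seq p q e e1 e2 : exec p e e1 -> exec q e1 e2 -> exec (p ;; q) e e2
| ex_loop0 r p e : e r = 0 -> exec (PLoop r p) e e
| ex_loopS r p e v e1 e2 :
    e r = S v -> exec p (upd e r v) e1 -> exec (PLoop r p) e1 e2 ->
    exec (PLoop r p) e e2.

(* Machine register 1 is kept at zero, so that [DEC 1 j] is an unconditional jump. *)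
Definition mreg (r : nat) : nat := match r with 0 => 0 | S r => S (S r) end.

(** Jumps are absolute, so [o] records the address at which the code will stand. A [PDec] on zero
    jumps to the next instruction, which makes it the truncated predecessor. *)
Fixpoint compile (o : nat) (p : prog) : list instr :=
  match p with
  | PInc r => [INC (mreg r)]
  | PDec r => [DEC (mreg r) (S o)]
  | PSeq p q => let c := compile o p in c ++ compile (o + length c) q
  | PLoop r p =>
      let c := compile (S o) p in
      DEC (mreg r) (S (S (o + length c))) :: c ++ [DEC 1 o]
  end.

Definition embed (e : nat -> nat) : nat -> nat :=
  fun r => match r with 0 => e 0 | 1 => 0 | S (S r) => e (S r) end.

Lemma embed_mreg e r : embed e (mreg r) = e r.
Proof. destruct r; reflexivity. Qed.

Lemma embed_upd e r v : upd (embed e) (mreg r) v = embed (upd e r v).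
Proof.
  extensionality x. unfold upd, embed, mreg.
  destruct r, x as [|[|x]]; reflexivity.
Qed.

Lemma upd_same e r : upd e r (e r) = e.
Proof. extensionality x. unfold upd. destruct (Nat.eqb_spec x r); congruence. Qed.

Lemma rm_run_add p n m c : rm_run p (n + m) c = rm_run p m (rm_run p n c).
Proof. revert c; induction n as [|n IH]; intros c; simpl; auto. Qed.

Definition reaches (code : list instr) (c c' : rm_config) : Prop :=
  exists n, rm_run code n c = c'.

Lemma reaches_refl code c : reaches code c c.
Proof. now exists 0. Qed.

Lemma reaches_trans code c1 c2 c3 :
  reaches code c1 c2 -> reaches code c2 c3 -> reaches code c1 c3.
Proof.
  intros [n Hn] [m Hm]. exists (n + m). now rewrite rm_run_add, Hn.
Qed.

Lemma reaches_step code c c1 c2 :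
  rm_step code c = c1 -> reaches code c1 c2 -> reaches code c c2.
Proof. intros H [n Hn]. exists (S n). simpl. now rewrite H. Qed.

Lemma nth_error_mid {A} (pre post : list A) x o :
  o = length pre -> nth_error (pre ++ x :: post) o = Some x.
Proof.
  intros ->. rewrite nth_error_app2 by lia. now rewrite Nat.sub_diag.
Qed.

(** The surrounding code is arbitrary, so that the induction hypotheses apply to a block inside a
    sequence or a loop. *)
Lemma compile_correct p e e' :
  exec p e e' ->
  forall pre post o, o = length pre ->
  reaches (pre ++ compile o p ++ post) (o, embed e)
          (o + length (compile o p), embed e').
Proof.
  induction 1 as [r e | r e | p q e e1 e2 H1 IH1 H2 IH2 | r p e H0
                 | r p e v e1 e2 H0 H1 IH1 H2 IH2]; intros pre post o Ho.
  - eapply reaches_step; [|apply reaches_refl]. simpl.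
    rewrite (nth_error_mid pre post) by auto.
    now rewrite embed_mreg, embed_upd, Nat.add_1_r.
  - eapply reaches_step; [|apply reaches_refl]. simpl.
    rewrite (nth_error_mid pre post) by auto.
    rewrite embed_mreg, Nat.add_1_r.
    destruct (e r) as [|v] eqn:E; simpl.
    + now rewrite <- E, upd_same.
    + now rewrite embed_upd.
  - simpl. set (c := compile o p) in *. set (d := compile (o + length c) q).
    eapply reaches_trans.
    + specialize (IH1 pre (d ++ post) o Ho). fold c in IH1.
      rewrite <- app_assoc. exact IH1.
    + specialize (IH2 (pre ++ c) post (o + length c)).
      fold d in IH2. rewrite length_app, Nat.add_assoc.
      rewrite <- app_assoc in IH2 |- *.
      apply IH2. rewrite length_app. lia.
  - eapply reaches_step; [|apply reaches_refl]. simpl.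
    rewrite (nth_error_mid pre) by auto.
    rewrite embed_mreg, H0, length_app. simpl. f_equal. lia.
  - eapply reaches_step.
    { simpl. rewrite (nth_error_mid pre) by auto.
      rewrite embed_mreg, H0, embed_upd. reflexivity. }
    simpl in *. set (c := compile (S o) p) in *.
    eapply reaches_trans.
    { specialize (IH1 (pre ++ [DEC (mreg r) (S (S (o + length c)))])
                      ([DEC 1 o] ++ post) (S o)).
      fold c in IH1. rewrite <- !app_assoc in IH1. rewrite <- app_assoc.
      apply IH1. rewrite length_app. simpl. lia. }
    eapply reaches_step; [|exact (IH2 pre post o Ho)].
    unfold rm_step. simpl app.
    replace (pre ++ DEC (mreg r) (S (S (o + length c))) :: (c ++ [DEC 1 o]) ++ post)
      with ((pre ++ DEC (mreg r) (S (S (o + length c))) :: c) ++ DEC 1 o :: post)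
      by (now rewrite <- !app_assoc; simpl; rewrite <- ?app_assoc).
    rewrite nth_error_mid by (rewrite length_app; simpl; lia).
    reflexivity.
Qed.

Definition env0 (x : nat) : nat -> nat := fun r => if r =? 0 then x else 0.

Lemma exec_halts p x e' :
  exec p (env0 x) e' -> halts_with (compile 0 p) x (e' 0).
Proof.
  intros H. destruct (compile_correct _ _ _ H [] [] 0 eq_refl) as [n Hn].
  rewrite app_nil_r in Hn. simpl in Hn. exists n.
  replace (rm_init x) with (0, embed (env0 x)).
  - rewrite Hn. simpl. split; [apply nth_error_None; lia | reflexivity].
  - unfold rm_init. f_equal. extensionality r. now destruct r as [|[|r]].
Qed.

Lemma exec_eq p e e1 e2 : exec p e e1 -> e1 = e2 -> exec p e e2.
Proof. now intros H <-. Qed.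

Ltac upd_cases :=
  unfold upd in *;
  repeat match goal with
         | |- context [?a =? ?b] => destruct (Nat.eqb_spec a b); try lia
         | H : context [?a =? ?b] |- _ => destruct (Nat.eqb_spec a b); try lia
         end.

Ltac env_eq :=
  let x := fresh "x" in extensionality x; upd_cases; subst; simpl; try lia; auto.

(** There is no empty program; incrementing and decrementing the next register is a loop body
    without effect. *)
Definition pclear (a : nat) : prog := PLoop a (PInc (S a) ;; PDec (S a)).

Lemma exec_clear a e : exec (pclear a) e (upd e a 0).
Proof.
  remember (e a) as n eqn:E. revert e E.
  induction n as [|n IH]; intros e E.
  - eapply exec_eq; [apply ex_loop0; auto|]. now rewrite E, upd_same.
  - eapply ex_loopS; [eauto | eapply ex_seq; constructor | ].
    eapply exec_eq; [apply IH; now upd_cases|]. env_eq.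
Qed.

Definition pmove (a b : nat) : prog := PLoop a (PInc b).

Lemma exec_move a b e :
  a <> b -> exec (pmove a b) e (upd (upd e b (e b + e a)) a 0).
Proof.
  intros Hab. remember (e a) as n eqn:E. revert e E.
  induction n as [|n IH]; intros e E.
  - eapply exec_eq; [apply ex_loop0; auto|]. env_eq.
  - eapply ex_loopS; [eauto | constructor | ].
    eapply exec_eq; [apply IH; now upd_cases|]. env_eq.
Qed.

(** Reading a register empties it, so the value is saved in [t], initially zero, and moved back. *)
Definition pcopy (a b t : nat) : prog := PLoop a (PInc b ;; PInc t) ;; pmove t a.

Lemma exec_copy a b t e :
  a <> b -> a <> t -> b <> t -> e t = 0 ->
  exec (pcopy a b t) e (upd e b (e b + e a)).
Proof.
  intros Hab Hat Hbt Ht. eapply ex_seq with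
    (e1 := upd (upd (upd e b (e b + e a)) t (e t + e a)) a 0).
  - clear Ht. remember (e a) as n eqn:E. revert e E.
    induction n as [|n IH]; intros e E.
    + eapply exec_eq; [apply ex_loop0; auto|]. env_eq.
    + eapply ex_loopS; [eauto | eapply ex_seq; constructor | ].
      eapply exec_eq; [apply IH; now upd_cases|]. env_eq.
  - eapply exec_eq; [apply exec_move; auto|]. env_eq.
Qed.

(** * The pairing function *)

Definition tri (s : nat) : nat := s * (s + 1) / 2.

Lemma tri_S s : tri (S s) = S s + tri s.
Proof.
  unfold tri. replace (S s * (S s + 1)) with (s * (s + 1) + S s * 2) by lia.
  rewrite Nat.div_add by lia. lia.
Qed.

Lemma cpair_tri x y : cpair x y = tri (x + y) + y.
Proof. reflexivity. Qed.

(** One step along the antidiagonals, in the order in which [cpair] numbers them; decoding then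
    needs neither division nor square root. *)
Definition next_pair (p : nat * nat) : nat * nat :=
  match p with (0, b) => (S b, 0) | (S a, b) => (a, S b) end.

Definition unpair (n : nat) : nat * nat := Nat.iter n next_pair (0, 0).

Lemma unpair_S n : unpair (S n) = next_pair (unpair n).
Proof. reflexivity. Qed.

Lemma unpair_tri s b : b <= s -> unpair (tri s + b) = (s - b, b).
Proof.
  revert b. induction s as [|s IHs].
  - intros b Hb. replace b with 0 by lia. reflexivity.
  - induction b as [|b IHb]; intros Hb.
    + rewrite tri_S. replace (S s + tri s + 0) with (S (tri s + s)) by lia.
      rewrite unpair_S, IHs by lia. simpl.
      now rewrite Nat.sub_diag.
    + replace (tri (S s) + S b) with (S (tri (S s) + b)) by lia.
      rewrite unpair_S, IHb by lia.
      replace (S s - b) with (S (S s - S b)) by lia. reflexivity.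
Qed.

Lemma unpair_cpair x y : unpair (cpair x y) = (x, y).
Proof. rewrite cpair_tri, unpair_tri by lia. f_equal. lia. Qed.

Lemma cpair_unpair n : cpair (fst (unpair n)) (snd (unpair n)) = n.
Proof.
  induction n as [|n IH]; [reflexivity|].
  rewrite unpair_S. destruct (unpair n) as [[|a] b]; simpl in *.
  - rewrite cpair_tri in *. rewrite !Nat.add_0_r, Nat.add_0_l, tri_S in *. lia.
  - rewrite cpair_tri in *. replace (a + S b) with (S a + b) by lia. lia.
Qed.

Lemma cpair_inj x y x' y' : cpair x y = cpair x' y' -> x = x' /\ y = y'.
Proof.
  intros H. apply (f_equal unpair) in H. rewrite !unpair_cpair in H.
  now injection H.
Qed.

Lemma cpair_ge_r x y : y <= cpair x y.
Proof. rewrite cpair_tri. lia. Qed.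

(** Once [k] holds the sum [x + y], the countdown adds [x + y], ..., 2, 1 to the copy of [y], which
    contributes the triangular number. The [PInc] in the body makes up for the decrement by the loop
    test. *)
Definition ppair (k : nat) : prog :=
  pcopy (k + 1) (k + 2) (k + 3) ;; pmove (k + 1) k ;;
  PLoop k (PInc (k + 2) ;; pcopy k (k + 2) (k + 3)) ;; pmove (k + 2) k.

Lemma exec_pair k e :
  (forall r, k + 1 < r -> e r = 0) ->
  exec (ppair k) e (upd (upd e k (cpair (e k) (e (k + 1)))) (k + 1) 0).
Proof.
  intros Hz.
  assert (L : forall s f, f k = s -> f (k + 3) = 0 ->
    exec (PLoop k (PInc (k + 2) ;; pcopy k (k + 2) (k + 3))) f
         (upd (upd f (k + 2) (f (k + 2) + tri s)) k 0)).
  { induction s as [|s IH]; intros f Hf H3.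
    - eapply exec_eq; [apply ex_loop0; auto|]. env_eq.
    - eapply ex_loopS; [eauto | eapply ex_seq; [constructor|apply exec_copy] | ];
        try lia; [now upd_cases |].
      eapply exec_eq; [apply IH; now upd_cases|].
      rewrite tri_S. env_eq. }
  eapply ex_seq; [apply exec_copy; try lia; apply Hz; lia|].
  eapply ex_seq; [apply exec_move; lia|].
  eapply ex_seq; [apply L; [reflexivity|]; upd_cases; apply Hz; lia|].
  eapply exec_eq; [apply exec_move; lia|].
  rewrite cpair_tri.
  assert (e (k + 2) = 0) by (apply Hz; lia).
  env_eq; rewrite ?H; try lia.
Qed.

(** Register [k] counts the steps of [next_pair], and the pair is kept in [k + 1] and [k + 2].
    Register [k + 3] is a flag that survives only if the first component is zero; [k + 4] holds that
    component temporarily. *)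
Definition punpair (k : nat) : prog :=
  PLoop k (PInc (k + 2) ;; PInc (k + 3) ;;
           PLoop (k + 1) (PInc (k + 4) ;; pclear (k + 3)) ;;
           PDec (k + 4) ;; pmove (k + 4) (k + 1) ;;
           PLoop (k + 3) (pmove (k + 2) (k + 1))) ;;
  pmove (k + 1) k ;; pmove (k + 2) (k + 1).

Lemma exec_unpair k e :
  (forall r, k < r -> e r = 0) ->
  exec (punpair k) e (upd (upd e k (fst (unpair (e k)))) (k + 1) (snd (unpair (e k)))).
Proof.
  intros Hz.
  assert (B : forall a b f, f (k + 1) = a -> f (k + 2) = b -> f (k + 3) = 0 ->
    f (k + 4) = 0 ->
    exec (PInc (k + 2) ;; PInc (k + 3) ;;
           PLoop (k + 1) (PInc (k + 4) ;; pclear (k + 3)) ;;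
           PDec (k + 4) ;; pmove (k + 4) (k + 1) ;;
           PLoop (k + 3) (pmove (k + 2) (k + 1))) f
      (upd (upd f (k + 1) (fst (next_pair (a, b)))) (k + 2) (snd (next_pair (a, b))))).
  { intros a b f Ha Hb Hf Ht.
    eapply ex_seq; [constructor|]. eapply ex_seq; [constructor|].
    assert (L : forall n g, g (k + 1) = S n ->
      exec (PLoop (k + 1) (PInc (k + 4) ;; pclear (k + 3))) g
        (upd (upd (upd g (k + 4) (g (k + 4) + S n)) (k + 3) 0) (k + 1) 0)).
    { induction n as [|n IH]; intros g Hg.
      - eapply ex_loopS; [eauto| eapply ex_seq; [constructor|apply exec_clear]|].
        eapply exec_eq; [apply ex_loop0; now upd_cases|]. env_eq.
      - eapply ex_loopS; [eauto| eapply ex_seq; [constructor|apply exec_clear]|].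
        eapply exec_eq; [apply IH; now upd_cases|]. env_eq. }
    destruct a as [|a]; simpl.
    - eapply ex_seq; [apply ex_loop0; upd_cases; lia|].
      eapply ex_seq; [constructor|].
      eapply ex_seq; [apply exec_move; lia|].
      eapply ex_loopS with (v := 0); [upd_cases; lia | apply exec_move; lia|].
      eapply exec_eq; [apply ex_loop0; now upd_cases|]. env_eq.
    - eapply ex_seq; [apply L; upd_cases; eauto|].
      eapply ex_seq; [constructor|].
      eapply ex_seq; [apply exec_move; lia|].
      eapply exec_eq; [apply ex_loop0; now upd_cases|]. env_eq. }
  set (body := PInc (k + 2) ;; _) in B.
  assert (L : forall n f p, f k = n -> (f (k + 1), f (k + 2)) = p ->
    f (k + 3) = 0 -> f (k + 4) = 0 ->
    exec (PLoop k body) f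
      (upd (upd (upd f k 0) (k + 1) (fst (Nat.iter n next_pair p)))
           (k + 2) (snd (Nat.iter n next_pair p)))).
  { induction n as [|n IH]; intros f p Hn Hp H3 H4.
    - eapply exec_eq; [apply ex_loop0; auto|]. subst p. simpl. env_eq.
    - eapply ex_loopS; [eauto | apply B; try reflexivity; now upd_cases|].
      eapply exec_eq.
      + eapply IH; [now upd_cases | reflexivity | now upd_cases | now upd_cases].
      + assert (E : forall A, @Nat.iter (S n) A = fun g x => Nat.iter n g (g x)).
        { intros A. extensionality g. extensionality x.
          now rewrite Nat.iter_succ_r. }
        rewrite E.
        match goal with |- context [Nat.iter n next_pair ?x] =>
          replace x with (next_pair p) end.
        * env_eq.
        * subst p. rewrite (surjective_pairing (next_pair _)) at 1.
          f_equal; upd_cases; reflexivity. }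
  eapply ex_seq; [eapply L; try reflexivity; apply Hz; lia|].
  eapply ex_seq; [apply exec_move; lia|].
  eapply exec_eq; [apply exec_move; lia|].
  unfold unpair. rewrite (Hz (k + 1)), (Hz (k + 2)) by lia.
  assert (E : forall r, k < r -> e r = 0) by assumption.
  extensionality x. upd_cases; subst; rewrite ?Nat.add_0_l; try reflexivity; try lia.
  symmetry; apply E; lia.
Qed.

(** * Computable unary functions *)

(* The program for base [k] computes in place in register [k], uses the registers above
   [k] as scratch space and leaves those below [k] alone. *)
Definition rm_computable (f : nat -> nat) : Prop :=
  exists P : nat -> prog, forall k e, (forall r, k < r -> e r = 0) ->
    exec (P k) e (upd e k (f (e k))).

Lemma Rec_ext f g : (forall x, f x = g x) -> rm_computable f -> rm_computable g.
Proof. intros H. replace g with f; auto. now extensionality x. Qed.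

Lemma Rec_comp f g : rm_computable f -> rm_computable g -> rm_computable (fun x => g (f x)).
Proof.
  intros [P HP] [Q HQ]. exists (fun k => P k ;; Q k). intros k e Hz.
  eapply ex_seq; [now apply HP|].
  eapply exec_eq; [apply HQ; intros; upd_cases; auto|]. env_eq.
Qed.

Lemma Rec_id : rm_computable (fun x => x).
Proof.
  exists (fun k => PInc k ;; PDec k). intros k e Hz.
  eapply ex_seq; [constructor|]. eapply exec_eq; [constructor|]. env_eq.
Qed.

Lemma Rec_S : rm_computable S.
Proof. exists PInc. intros k e Hz. constructor. Qed.

Lemma Rec_const n : rm_computable (fun _ => n).
Proof.
  induction n as [|n IH].
  - exists pclear. intros. apply exec_clear.
  - exact (Rec_comp _ _ IH Rec_S).
Qed.

Lemma Rec_pair f g :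
  rm_computable f -> rm_computable g -> rm_computable (fun x => cpair (f x) (g x)).
Proof.
  intros [P HP] [Q HQ].
  exists (fun k => pcopy k (k + 1) (k + 2) ;; P (k + 1) ;;
                   pcopy k (k + 2) (k + 3) ;; Q (k + 2) ;; pclear k ;;
                   pmove (k + 1) k ;; pmove (k + 2) (k + 1) ;; ppair k).
  intros k e Hz.
  eapply ex_seq; [apply exec_copy; try lia; apply Hz; lia|].
  eapply ex_seq; [apply HP; intros; upd_cases; apply Hz; lia|].
  eapply ex_seq; [apply exec_copy; try lia; upd_cases; apply Hz; lia|].
  eapply ex_seq; [apply HQ; intros; upd_cases; apply Hz; lia|].
  eapply ex_seq; [apply exec_clear|].
  eapply ex_seq; [apply exec_move; lia|].
  eapply ex_seq; [apply exec_move; lia|].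
  eapply exec_eq; [apply exec_pair; intros; upd_cases; apply Hz; lia|].
  assert (H1 : e (k + 1) = 0) by (apply Hz; lia).
  assert (H2 : e (k + 2) = 0) by (apply Hz; lia).
  env_eq; rewrite ?H1, ?H2, ?Nat.add_0_l, ?Nat.add_0_r; auto.
Qed.

Lemma Rec_left : rm_computable (fun x => fst (unpair x)).
Proof.
  exists (fun k => punpair k ;; pclear (k + 1)). intros k e Hz.
  eapply ex_seq; [now apply exec_unpair|].
  eapply exec_eq; [apply exec_clear|].
  assert (H1 : e (k + 1) = 0) by (apply Hz; lia). env_eq.
Qed.

Lemma Rec_right : rm_computable (fun x => snd (unpair x)).
Proof.
  exists (fun k => punpair k ;; pclear k ;; pmove (k + 1) k). intros k e Hz.
  eapply ex_seq; [now apply exec_unpair|].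
  eapply ex_seq; [apply exec_clear|].
  eapply exec_eq; [apply exec_move; lia|].
  assert (H1 : e (k + 1) = 0) by (apply Hz; lia). env_eq.
Qed.

Lemma Rec_iter f :
  rm_computable f -> rm_computable (fun x => Nat.iter (fst (unpair x)) f (snd (unpair x))).
Proof.
  intros [P HP].
  exists (fun k => punpair k ;; PLoop k (P (k + 1)) ;; pmove (k + 1) k).
  intros k e Hz.
  assert (L : forall n g, g k = n -> (forall r, k + 1 < r -> g r = 0) ->
    exec (PLoop k (P (k + 1))) g
         (upd (upd g k 0) (k + 1) (Nat.iter n f (g (k + 1))))).
  { induction n as [|n IH]; intros g Hg Hr.
    - eapply exec_eq; [apply ex_loop0; auto|]. simpl. env_eq.
    - eapply ex_loopS; [eauto | apply HP; intros; upd_cases; auto |].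
      eapply exec_eq; [apply IH; [now upd_cases| intros; upd_cases; auto]|].
      rewrite Nat.iter_succ_r. env_eq. }
  eapply ex_seq; [now apply exec_unpair|].
  eapply ex_seq; [apply L; [reflexivity|intros; upd_cases; apply Hz; lia]|].
  eapply exec_eq; [apply exec_move; lia|].
  assert (H1 : e (k + 1) = 0) by (apply Hz; lia). env_eq.
Qed.

(* Unbounded search: [t x n = 0] means that the search stops at [n], with answer [o x n]. *)
Lemma Rec_search t o :
  rm_computable (fun z => t (fst (unpair z)) (snd (unpair z))) ->
  rm_computable (fun z => o (fst (unpair z)) (snd (unpair z))) ->
  exists p, forall x, (exists n, t x n = 0) ->
    exists n, t x n = 0 /\ halts_with p x (o x n).
Proof.
  intros Ht Ho.
  assert (Hn : rm_computable (fun z => cpair (fst (unpair z)) (S (snd (unpair z))))).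
  { apply Rec_pair; [apply Rec_left|].
    exact (Rec_comp _ _ Rec_right Rec_S). }
  destruct (Rec_pair _ _ Rec_id (Rec_const 0)) as [I HI].
  destruct Ht as [T HT], Ho as [O HO], Hn as [N HN].
  (* Register 0 holds the pair of input and candidate, register 1 the value of the test, which ends
     the loop when it is zero. *)
  set (test := pcopy 0 1 2 ;; T 1).
  set (loop := PLoop 1 (pclear 1 ;; N 0 ;; test)).
  exists (compile 0 (I 0 ;; test ;; loop ;; pclear 1 ;; O 0)).
  assert (Et : forall x n, exec test (env0 (cpair x n)) (upd (env0 (cpair x n)) 1 (t x n))).
  { intros x n. eapply ex_seq; [apply exec_copy; auto|].
    eapply exec_eq; [apply HT; intros; unfold env0; upd_cases; auto|].
    change (upd (env0 (cpair x n)) 1 (env0 (cpair x n) 1 + env0 (cpair x n) 0) 1)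
      with (cpair x n).
    rewrite unpair_cpair. unfold env0. env_eq. }
  (* [d] is the distance to a known zero of the test; the search may stop before it, at some other
     [m']. *)
  assert (L : forall x d m, t x (d + m) = 0 ->
    exists m', t x m' = 0 /\
      exec loop (upd (env0 (cpair x m)) 1 (t x m)) (env0 (cpair x m'))).
  { intros x. induction d as [|d IH]; intros m Hm.
    - exists m. split; auto. eapply exec_eq; [apply ex_loop0; auto|].
      simpl in Hm. rewrite Hm. unfold env0. env_eq.
    - destruct (t x m) as [|v] eqn:E.
      { exists m. split; auto. eapply exec_eq; [apply ex_loop0; auto|].
        unfold env0. env_eq. }
      destruct (IH (S m)) as (m' & Hm' & Hl); [now rewrite <- Hm, Nat.add_succ_r|].
      exists m'. split; auto. eapply ex_loopS; [reflexivity| |exact Hl].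
      eapply ex_seq; [apply exec_clear|].
      eapply ex_seq; [|apply Et].
      eapply exec_eq; [apply HN; intros; unfold env0; upd_cases; auto|].
      change (upd (upd (upd (env0 (cpair x m)) 1 (S v)) 1 v) 1 0 0) with (cpair x m).
      rewrite unpair_cpair. unfold env0. env_eq. }
  intros x [n Hn]. destruct (L x n 0) as (m & Hm & Hl); [now rewrite Nat.add_0_r|].
  exists m. split; auto.
  replace (o x m) with (upd (env0 (cpair x m)) 0 (o x m) 0) by reflexivity.
  apply exec_halts.
  eapply ex_seq.
  { eapply exec_eq; [apply HI; intros; unfold env0; upd_cases; auto|].
    instantiate (1 := env0 (cpair x 0)). unfold env0. env_eq. }
  eapply ex_seq; [apply Et|].
  eapply ex_seq; [apply Hl|].
  eapply ex_seq; [apply exec_clear|].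
  eapply exec_eq; [apply HO; intros; unfold env0; upd_cases; auto|].
  change (upd (env0 (cpair x m)) 1 0 0) with (cpair x m).
  rewrite unpair_cpair. unfold env0. env_eq.
Qed.

(** * Computable functions between encoded types *)

Lemma Rec_pred : rm_computable pred.
Proof. exists PDec. intros k e Hz. constructor. Qed.

(** The instances are built from [cpair] and [enc_list], so that they reproduce the encoding fixed
    in the problem. *)
Class Enc (A : Type) : Type := enc : A -> nat.

#[global] Instance enc_nat : Enc nat := fun n => n.
#[global] Instance enc_bool : Enc bool := fun b => if b then 1 else 0.
#[global] Instance enc_prod {A B} `{Enc A} `{Enc B} : Enc (A * B) :=
  fun p => cpair (enc (fst p)) (enc (snd p)).
#[global] Instance enc_seq {A} `{Enc A} : Enc (list A) := fun l => enc_list (map enc l).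

Definition injective {A} `{Enc A} : Prop := forall x y : A, enc x = enc y -> x = y.

(** Needed for types of certificates: the search tries all numbers, and each has to be the code of
    something. *)
Definition surjective {A} `{Enc A} : Prop := forall n, exists x : A, enc x = n.

Lemma injective_nat : @injective nat _.
Proof. intros x y H. exact H. Qed.

Lemma injective_prod {A B} `{Enc A} `{Enc B} :
  @injective A _ -> @injective B _ -> @injective (A * B) _.
Proof.
  intros HA HB [x y] [x' y'] E. apply cpair_inj in E as [E1 E2].
  f_equal; auto.
Qed.

Lemma injective_list {A} `{Enc A} : @injective A _ -> @injective (list A) _.
Proof.
  intros HA x. induction x as [|a x IH]; intros [|b y] E; try discriminate; auto.
  injection E as E. apply cpair_inj in E as [E1 E2].
  f_equal; auto.
Qed.

Lemma surjective_nat : @surjective nat _.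
Proof. intros n. now exists n. Qed.

Lemma surjective_prod {A B} `{Enc A} `{Enc B} :
  @surjective A _ -> @surjective B _ -> @surjective (A * B) _.
Proof.
  intros HA HB n. destruct (HA (fst (unpair n))) as [x Hx].
  destruct (HB (snd (unpair n))) as [y Hy].
  exists (x, y). cbv [enc enc_prod fst snd] in *. rewrite Hx, Hy. apply cpair_unpair.
Qed.

Lemma surjective_list {A} `{Enc A} : @surjective A _ -> @surjective (list A) _.
Proof.
  intros HA n. induction n as [n IH] using lt_wf_ind. destruct n as [|n].
  - now exists [].
  - destruct (HA (fst (unpair n))) as [x Hx].
    destruct (IH (snd (unpair n))) as [l Hl].
    + rewrite <- (cpair_unpair n) at 2. apply Nat.lt_succ_r, cpair_ge_r.
    + exists (x :: l). cbv [enc enc_seq] in *. simpl.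
      rewrite Hx, Hl. f_equal. apply cpair_unpair.
Qed.

(** On numbers that are not codes, [g] is unconstrained. *)
Definition computable {X A} `{Enc X} `{Enc A} (f : X -> A) : Prop :=
  exists g, rm_computable g /\ forall x, g (enc x) = enc (f x).

Section Basics.
Context {X : Type} `{EX : Enc X}.

Lemma cmp_ext {A} `{Enc A} (f g : X -> A) : (forall x, f x = g x) -> computable f -> computable g.
Proof. intros E [h [Hh Hf]]. exists h. split; auto. intros x. now rewrite <- E. Qed.

Lemma cmp_id : computable (fun x : X => x).
Proof. exists (fun x => x). split; auto using Rec_id. Qed.

Lemma cmp_const {A} `{Enc A} (a : A) : computable (fun _ : X => a).
Proof. exists (fun _ => enc a). split; auto using Rec_const. Qed.

Lemma cmp_enc {A} `{Enc A} (f : X -> A) : computable f -> computable (fun x => enc (f x)).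
Proof. intros [g [Hg E]]; exists g; auto. Qed.

Lemma cmp_of_enc {A} `{Enc A} (f : X -> A) : computable (fun x => enc (f x)) -> computable f.
Proof. intros [g [Hg E]]; exists g; auto. Qed.

Lemma cmp_S (f : X -> nat) : computable f -> computable (fun x => S (f x)).
Proof.
  intros [f' [Rf Hf]]. exists (fun x => S (f' x)).
  split; [exact (Rec_comp f' S Rf Rec_S)|]. intros x. now rewrite Hf.
Qed.

Lemma cmp_pred (f : X -> nat) : computable f -> computable (fun x => pred (f x)).
Proof.
  intros [f' [Rf Hf]]. exists (fun x => pred (f' x)).
  split; [exact (Rec_comp f' pred Rf Rec_pred)|]. intros x. now rewrite Hf.
Qed.

Lemma cmp_pair {A B} `{Enc A} `{Enc B} (f : X -> A) (g : X -> B) :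
  computable f -> computable g -> computable (fun x => (f x, g x)).
Proof.
  intros [f' [Rf Hf]] [g' [Rg Hg]]. exists (fun x => cpair (f' x) (g' x)).
  split; [now apply Rec_pair|]. intros x. now rewrite Hf, Hg.
Qed.

Lemma cmp_fst {A B} `{Enc A} `{Enc B} (f : X -> A * B) :
  computable f -> computable (fun x => fst (f x)).
Proof.
  intros [f' [Rf Hf]]. exists (fun x => fst (unpair (f' x))).
  split; [exact (Rec_comp f' (fun x => fst (unpair x)) Rf Rec_left)|].
  intros x. rewrite Hf.
  change (enc (f x)) with (cpair (enc (fst (f x))) (enc (snd (f x)))).
  now rewrite unpair_cpair.
Qed.

Lemma cmp_snd {A B} `{Enc A} `{Enc B} (f : X -> A * B) :
  computable f -> computable (fun x => snd (f x)).
Proof.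
  intros [f' [Rf Hf]]. exists (fun x => snd (unpair (f' x))).
  split; [exact (Rec_comp f' (fun x => snd (unpair x)) Rf Rec_right)|].
  intros x. rewrite Hf.
  change (enc (f x)) with (cpair (enc (fst (f x))) (enc (snd (f x)))).
  now rewrite unpair_cpair.
Qed.

Lemma cmp_iter {B} `{Enc B} (n : X -> nat) (f : X -> B -> B) (i : X -> B) :
  computable n -> computable (fun p : X * B => f (fst p) (snd p)) -> computable i ->
  computable (fun x => Nat.iter (n x) (f x) (i x)).
Proof.
  intros [n' [Rn Hn]] [f' [Rf Hf]] [i' [Ri Hi]].
  (* The iterated function is unary, so it carries the parameter [x] along in its first
     component. *)
  set (s := fun z => cpair (fst (unpair z)) (f' z)).
  exists (fun x => snd (unpair (Nat.iter (n' x) s (cpair x (i' x))))). split.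
  - apply Rec_comp with (f := fun x => Nat.iter (n' x) s (cpair x (i' x)))
      (g := fun z => snd (unpair z));
      [|apply Rec_right].
    apply Rec_ext with (f := fun x =>
      (fun z => Nat.iter (fst (unpair z)) s (snd (unpair z)))
        (cpair (n' x) (cpair x (i' x)))).
    { intros x. now rewrite !unpair_cpair. }
    apply (Rec_comp (fun x => cpair (n' x) (cpair x (i' x)))
             (fun z => Nat.iter (fst (unpair z)) s (snd (unpair z)))).
    + auto using Rec_pair, Rec_id.
    + apply Rec_iter. apply Rec_pair; auto using Rec_left.
  - intros x. rewrite Hn, Hi. change (enc (n x)) with (n x).
    assert (E : Nat.iter (n x) s (cpair (enc x) (enc (i x))) =
                cpair (enc x) (enc (Nat.iter (n x) (f x) (i x)))).
    { induction (n x) as [|m IH]; [reflexivity|].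
      simpl. rewrite IH. unfold s at 1. rewrite unpair_cpair. simpl.
      f_equal. exact (Hf (x, _)). }
    now rewrite E, unpair_cpair.
Qed.

End Basics.

Lemma cmp_app {X A B} `{Enc X} `{Enc A} `{Enc B} (f : A -> B) (g : X -> A) :
  computable f -> computable g -> computable (fun x => f (g x)).
Proof.
  intros [f' [Rf Hf]] [g' [Rg Hg]]. exists (fun x => f' (g' x)).
  split; [now apply (Rec_comp g' f')|]. intros x. now rewrite Hg, Hf.
Qed.

Ltac cmp_base :=
  lazymatch goal with
  | |- computable (fun x => x) => apply cmp_id
  | |- computable fst => apply (cmp_fst (fun x => x))
  | |- computable snd => apply (cmp_snd (fun x => x))
  | |- computable (fun x => (@?f x, @?g x)) => apply (cmp_pair f g)
  | |- computable (fun x => fst (@?f x)) => apply (cmp_fst f)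
  | |- computable (fun x => snd (@?f x)) => apply (cmp_snd f)
  | |- computable (fun x => S (@?f x)) => apply (cmp_S f)
  | |- computable (fun x => pred (@?f x)) => apply (cmp_pred f)
  | |- computable (fun _ => ?c) => apply (cmp_const c)
  end.
(** A hook, redefined once arithmetic and list functions are known to be computable. *)
Ltac cmp_more := fail.
Ltac cmp_hyp :=
  match goal with
  | H : computable ?f |- computable ?f => exact H
  | H : computable ?f |- computable (fun x => ?f (@?g x)) => apply (cmp_app f g H)
  | H : computable (fun p => ?f (fst p) (snd p)) |- computable (fun x => ?f (@?g x) (@?h x)) =>
      apply (cmp_app (fun p => f (fst p) (snd p)) (fun x => (g x, h x)) H)
  | H : computable (fun p => ?f (fst (fst p)) (snd (fst p)) (snd p))
    |- computable (fun x => ?f (@?g x) (@?h x) (@?k x)) =>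
      apply (cmp_app (fun p => f (fst (fst p)) (snd (fst p)) (snd p))
               (fun x => (g x, h x, k x)) H)
  end.
Ltac cmp_auto := repeat (cbv beta; first [cmp_hyp | cmp_base | cmp_more]).

Section Arithmetic.
Context {X : Type} `{EX : Enc X}.

(** A conditional is an iteration performed once or not at all. *)
Lemma cmp_if {A} `{Enc A} (b : X -> bool) (f g : X -> A) :
  computable b -> computable f -> computable g -> computable (fun x => if b x then f x else g x).
Proof.
  intros Hb Hf Hg.
  apply cmp_ext with (f := fun x => Nat.iter (enc (b x)) (fun _ => f x) (g x)).
  - intros x. now destruct (b x).
  - apply (cmp_iter (fun x => enc (b x)) (fun x _ => f x)); auto using cmp_enc.
    cmp_auto.
Qed.

Lemma cmp_zero (f : X -> nat) : computable f -> computable (fun x => f x =? 0).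
Proof.
  intros Hf. apply cmp_ext with (f := fun x => Nat.iter (f x) (fun _ => false) true).
  - intros x. now destruct (f x).
  - apply (cmp_iter f (fun _ _ => false)); cmp_auto.
Qed.

Lemma cmp_add (f g : X -> nat) : computable f -> computable g -> computable (fun x => f x + g x).
Proof.
  intros Hf Hg. apply cmp_ext with (f := fun x => Nat.iter (f x) S (g x)).
  - intros x. induction (f x); simpl; auto.
  - apply (cmp_iter f (fun _ => S)); cmp_auto.
Qed.

Lemma cmp_sub (f g : X -> nat) : computable f -> computable g -> computable (fun x => f x - g x).
Proof.
  intros Hf Hg. apply cmp_ext with (f := fun x => Nat.iter (g x) pred (f x)).
  - intros x. induction (g x) as [|n IH]; simpl; [lia|]. rewrite IH. lia.
  - apply (cmp_iter g (fun _ => pred)); cmp_auto.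
Qed.

Lemma cmp_eqb (f g : X -> nat) : computable f -> computable g -> computable (fun x => f x =? g x).
Proof.
  intros Hf Hg. apply cmp_ext with (f := fun x => (f x - g x) + (g x - f x) =? 0).
  - intros x. destruct (Nat.eqb_spec (f x) (g x)), (Nat.eqb_spec (f x - g x + (g x - f x)) 0);
      auto; lia.
  - apply cmp_zero, cmp_add; now apply cmp_sub.
Qed.

Definition eqe {A} `{Enc A} (a b : A) : bool := enc a =? enc b.

Lemma cmp_eqe {A} `{Enc A} (f g : X -> A) :
  computable f -> computable g -> computable (fun x => eqe (f x) (g x)).
Proof. intros Hf Hg. exact (cmp_eqb _ _ (cmp_enc f Hf) (cmp_enc g Hg)). Qed.

Lemma cmp_cons {A} `{Enc A} (f : X -> A) (g : X -> list A) :
  computable f -> computable g -> computable (fun x => f x :: g x).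
Proof.
  intros [f' [Rf Hf]] [g' [Rg Hg]]. exists (fun x => S (cpair (f' x) (g' x))).
  split; [apply (Rec_comp (fun x => cpair (f' x) (g' x)) S); auto using Rec_pair, Rec_S|].
  intros x. now rewrite Hf, Hg.
Qed.

Lemma cmp_tl {A} `{Enc A} (f : X -> list A) : computable f -> computable (fun x => tl (f x)).
Proof.
  intros [f' [Rf Hf]]. exists (fun x => snd (unpair (pred (f' x)))). split.
  - apply (Rec_comp (fun x => pred (f' x)) (fun x => snd (unpair x)));
      [exact (Rec_comp f' pred Rf Rec_pred) | apply Rec_right].
  - intros x. rewrite Hf. destruct (f x) as [|a l]; [reflexivity|].
    change (enc (a :: l)) with (S (cpair (enc a) (enc l))). simpl.
    now rewrite unpair_cpair.
Qed.

End Arithmetic.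

(** * Computability of list functions *)

Lemma length_le_enc {A} `{Enc A} (l : list A) : length l <= enc l.
Proof.
  induction l as [|a l IH]; simpl; [lia|].
  change (enc (a :: l)) with (S (cpair (enc a) (enc l))).
  pose proof (cpair_ge_r (enc a) (enc l)). lia.
Qed.

(** The loop runs [enc (l x)] times, a bound on the length that is available for free. Its state
    consists of the codes of the remaining list and of the accumulator; once the list is used up,
    the remaining rounds are idle. *)
Lemma cmp_fold {X A B} `{Enc X} `{Enc A} `{Enc B} (f : X -> B -> A -> B) (l : X -> list A) (i : X -> B) :
  computable (fun p : X * B * A => f (fst (fst p)) (snd (fst p)) (snd p)) ->
  computable l -> computable i ->
  computable (fun x => fold_left (f x) (l x) (i x)).
Proof.
  intros [f' [Rf Hf]] Hl Hi.
  set (F := fun (x : X) (b a : nat) => f' (cpair (cpair (enc x) b) a)).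
  set (h := fun (x : X) (s : nat * nat) =>
    if fst s =? 0 then s
    else (snd (unpair (pred (fst s))), F x (snd s) (fst (unpair (pred (fst s)))))).
  assert (Ch : computable (fun p : X * (nat * nat) => h (fst p) (snd p))).
  (* A number and the pair it decodes to have the same code, so the identity tracks [unpair]. *)
  { assert (C1 : computable unpair).
    { exists (fun n => n). split; [apply Rec_id|].
      intros n. symmetry. apply cpair_unpair. }
    assert (C2 : computable (fun p : X * nat * nat => F (fst (fst p)) (snd (fst p)) (snd p))).
    { exists f'. now split. }
    unfold h. apply cmp_if; [apply cmp_zero|..]; cmp_auto. }
  apply cmp_of_enc.
  apply cmp_ext with (f := fun x => snd (Nat.iter (enc (l x)) (h x) (enc (l x), enc (i x)))).
  2: { apply cmp_snd, cmp_iter; auto using cmp_enc, cmp_pair. }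
  - intros x.
    enough (E : forall n k b, length k <= n ->
      snd (Nat.iter n (h x) (enc k, enc b)) = enc (fold_left (f x) k b)).
    { apply E, length_le_enc. }
    induction n as [|n IH]; intros k b Hn.
    + destruct k; [reflexivity|simpl in Hn; lia].
    + rewrite Nat.iter_succ_r. destruct k as [|a k].
      * exact (IH [] b (Nat.le_0_l _)).
      * simpl in Hn. simpl fold_left. rewrite <- IH by lia. f_equal. f_equal.
        change (enc (a :: k)) with (S (cpair (enc a) (enc k))).
        unfold h, F. simpl. rewrite unpair_cpair. simpl. f_equal.
        exact (Hf (x, b, a)).
Qed.

Lemma cmp_rev {X A} `{Enc X} `{Enc A} (l : X -> list A) :
  computable l -> computable (fun x => rev (l x)).
Proof.
  intros Hl.
  apply cmp_ext with (f := fun x => fold_left (fun b a => a :: b) (l x) []).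
  - intros x. symmetry. rewrite <- (app_nil_r (rev (l x))). generalize (@nil A).
    induction (l x) as [|a k IH]; intros b; simpl; auto.
    rewrite <- app_assoc. apply IH.
  - apply (cmp_fold (fun _ b a => a :: b)); auto; [apply cmp_cons|]; cmp_auto.
Qed.

Lemma cmp_append {X A} `{Enc X} `{Enc A} (l k : X -> list A) :
  computable l -> computable k -> computable (fun x => l x ++ k x).
Proof.
  intros Hl Hk.
  apply cmp_ext with (f := fun x => fold_left (fun b a => a :: b) (rev (l x)) (k x)).
  - intros x. rewrite <- (rev_involutive (l x)) at 2. generalize (k x).
    induction (rev (l x)) as [|a r IH]; intros b; simpl; auto.
    rewrite <- app_assoc. apply IH.
  - apply (cmp_fold (fun _ b a => a :: b)); auto using cmp_rev. apply cmp_cons; cmp_auto.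
Qed.

Lemma cmp_flat_map {X A B} `{Enc X} `{Enc A} `{Enc B} (f : X -> A -> list B) (l : X -> list A) :
  computable (fun p : X * A => f (fst p) (snd p)) ->
  computable l -> computable (fun x => flat_map (f x) (l x)).
Proof.
  intros Hf Hl.
  apply cmp_ext with (f := fun x => fold_left (fun b a => b ++ f x a) (l x) []).
  - intros x. rewrite <- (app_nil_l (flat_map _ _)). generalize (@nil B).
    induction (l x) as [|a k IH]; intros b; simpl; [now rewrite app_nil_r|].
    rewrite IH. now rewrite app_assoc.
  - apply (cmp_fold (fun x b a => b ++ f x a)); auto; [apply cmp_append|]; cmp_auto.
Qed.

Lemma cmp_map {X A B} `{Enc X} `{Enc A} `{Enc B} (f : X -> A -> B) (l : X -> list A) :
  computable (fun p : X * A => f (fst p) (snd p)) ->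
  computable l -> computable (fun x => map (f x) (l x)).
Proof.
  intros Hf Hl.
  apply cmp_ext with (f := fun x => flat_map (fun a => [f x a]) (l x)).
  - intros x. induction (l x) as [|a k IH]; simpl; congruence.
  - apply (cmp_flat_map (fun x a => [f x a])); auto. apply cmp_cons; cmp_auto.
Qed.

Lemma cmp_filter {X A} `{Enc X} `{Enc A} (f : X -> A -> bool) (l : X -> list A) :
  computable (fun p : X * A => f (fst p) (snd p)) ->
  computable l -> computable (fun x => filter (f x) (l x)).
Proof.
  intros Hf Hl.
  apply cmp_ext with (f := fun x => flat_map (fun a => if f x a then [a] else []) (l x)).
  - intros x. induction (l x) as [|a k IH]; simpl; auto. destruct (f x a); simpl; congruence.
  - apply (cmp_flat_map (fun x (a : A) => if f x a then [a] else [])); auto.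
    apply cmp_if; [| apply cmp_cons|]; cmp_auto.
Qed.

Lemma cmp_forallb {X A} `{Enc X} `{Enc A} (f : X -> A -> bool) (l : X -> list A) :
  computable (fun p : X * A => f (fst p) (snd p)) ->
  computable l -> computable (fun x => forallb (f x) (l x)).
Proof.
  intros Hf Hl.
  apply cmp_ext with (f := fun x => fold_left (fun (b : bool) a => if b then f x a else false) (l x) true).
  - intros x. induction (l x) as [|a k IH]; simpl; auto.
    rewrite <- IH. destruct (f x a); auto. simpl.
    clear. induction k; simpl; auto.
  - apply (cmp_fold (fun x (b : bool) a => if b then f x a else false)); auto; [apply cmp_if|]; cmp_auto.
Qed.

Lemma cmp_existsb {X A} `{Enc X} `{Enc A} (f : X -> A -> bool) (l : X -> list A) :
  computable (fun p : X * A => f (fst p) (snd p)) ->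
  computable l -> computable (fun x => existsb (f x) (l x)).
Proof.
  intros Hf Hl.
  apply cmp_ext with (f := fun x => if forallb (fun a => if f x a then false else true) (l x)
                                    then false else true).
  - intros x. induction (l x) as [|a k IH]; simpl; auto. destruct (f x a); auto.
  - apply cmp_if; cmp_auto.
    apply (cmp_forallb (fun x a => if f x a then false else true)); auto.
    apply cmp_if; cmp_auto.
Qed.

Lemma cmp_nth {X A} `{Enc X} `{Enc A} (n : X -> nat) (l : X -> list A) (d : X -> A) :
  computable n -> computable l -> computable d -> computable (fun x => nth (n x) (l x) (d x)).
Proof.
  intros Hn Hl Hd.
  (* The fold takes the head of what is left after [n x] tails: its flag blocks every element but
     the first. *)
  apply cmp_ext with (f := fun x =>
    snd (fold_left (fun (s : bool * A) a => if fst s then s else (true, a))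
           (Nat.iter (n x) (@tl A) (l x)) (false, d x))).
  - intros x. transitivity (hd (d x) (Nat.iter (n x) (@tl A) (l x))).
    + destruct (Nat.iter (n x) (@tl A) (l x)) as [|a k]; simpl; auto.
      induction k; simpl; auto.
    + generalize (l x). induction (n x) as [|m IH]; intros [|a k]; simpl; auto.
      * rewrite <- Nat.iter_succ, Nat.iter_succ_r. simpl.
        rewrite IH. now destruct m.
      * rewrite <- Nat.iter_succ, Nat.iter_succ_r. apply IH.
  - apply cmp_snd, (cmp_fold (fun _ (s : bool * A) a => if fst s then s else (true, a))).
    + apply cmp_if; cmp_auto.
    + apply (cmp_iter n (fun _ => @tl A)); auto. apply cmp_tl; cmp_auto.
    + cmp_auto.
Qed.

Lemma cmp_seq {X} `{Enc X} (n : X -> nat) : computable n -> computable (fun x => seq 0 (n x)).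
Proof.
  intros Hn.
  apply cmp_ext with (f := fun x =>
    snd (Nat.iter (n x) (fun s => (S (fst s), snd s ++ [fst s])) (0, []))).
  - intros x. enough (E : forall m, Nat.iter m (fun s => (S (fst s), snd s ++ [fst s])) (0, [])
                                   = (m, seq 0 m)) by now rewrite E.
    induction m as [|m IH]; [reflexivity|].
    rewrite Nat.iter_succ, IH. simpl fst. simpl snd. now rewrite seq_S.
  - apply cmp_snd, (cmp_iter n (fun _ s => (S (fst s), snd s ++ [fst s]))); auto.
    + cmp_auto. apply cmp_append; [|apply cmp_cons]; cmp_auto.
    + cmp_auto.
Qed.

Lemma cmp_length {X A} `{Enc X} `{Enc A} (l : X -> list A) :
  computable l -> computable (fun x => length (l x)).
Proof.
  intros Hl. apply cmp_ext with (f := fun x => fold_left (fun b _ => S b) (l x) 0).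
  - intros x. rewrite <- (Nat.add_0_r (length _)). generalize 0.
    induction (l x) as [|a k IH]; intros b; simpl; auto. rewrite IH. lia.
  - apply (cmp_fold (fun _ b _ => S b)); cmp_auto.
Qed.

Lemma cmp_andb {X} `{Enc X} (f g : X -> bool) :
  computable f -> computable g -> computable (fun x => f x && g x)%bool.
Proof. intros. apply cmp_if; cmp_auto. Qed.

Lemma cmp_negb {X} `{Enc X} (f : X -> bool) : computable f -> computable (fun x => negb (f x)).
Proof. intros. apply cmp_if; cmp_auto. Qed.

Lemma cmp_implb {X} `{Enc X} (f g : X -> bool) :
  computable f -> computable g -> computable (fun x => implb (f x) (g x)).
Proof. intros. apply cmp_if; cmp_auto. Qed.

Ltac cmp_more ::=
  lazymatch goal with
  | |- computable (fun x => if @?b x then @?f x else @?g x) => apply (cmp_if b f g)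
  | |- computable (fun x => @?f x && @?g x)%bool => apply (cmp_andb f g)
  | |- computable (fun x => negb (@?f x)) => apply (cmp_negb f)
  | |- computable (fun x => implb (@?f x) (@?g x)) => apply (cmp_implb f g)
  | |- computable (fun x => @?f x + @?g x) => apply (cmp_add f g)
  | |- computable (fun x => @?f x =? @?g x) => apply (cmp_eqb f g)
  | |- computable (fun x => eqe (@?f x) (@?g x)) => apply (cmp_eqe f g)
  | |- computable (fun x => @?f x :: @?g x) => apply (cmp_cons f g)
  | |- computable (fun x => tl (@?f x)) => apply (cmp_tl f)
  | |- computable (fun x => @?f x ++ @?g x) => apply (cmp_append f g)
  | |- computable (fun x => length (@?f x)) => apply (cmp_length f)
  | |- computable (fun x => seq 0 (@?f x)) => apply (cmp_seq f)
  | |- computable (fun x => nth (@?f x) (@?g x) (@?h x)) => apply (cmp_nth f g h)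
  | |- computable (fun x => map (@?f x) (@?l x)) => apply (cmp_map f l)
  | |- computable (fun x => filter (@?f x) (@?l x)) => apply (cmp_filter f l)
  | |- computable (fun x => forallb (@?f x) (@?l x)) => apply (cmp_forallb f l)
  | |- computable (fun x => existsb (@?f x) (@?l x)) => apply (cmp_existsb f l)
  | |- computable (fun x => flat_map (@?f x) (@?l x)) => apply (cmp_flat_map f l)
  | |- computable (fun x => fold_left (@?f x) (@?l x) (@?i x)) => apply (cmp_fold f l i)
  end.

(** * Decidability from two semidecision procedures *)

(** The search reads each number both as a certificate for yes and as one for no. Completeness makes
    it stop, and soundness makes its answer correct, whichever certificate stopped it. *)
Lemma decidable_of_certificates {A T C1 C2} `{Enc T} `{Enc C1} `{Enc C2}
  (enc_a : A -> nat) (conv : A -> T) (Dom P : A -> Prop)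
  (yes : T -> C1 -> bool) (no : T -> C2 -> bool) :
  (forall a, enc (conv a) = enc_a a) ->
  @surjective C1 _ -> @surjective C2 _ ->
  computable (fun p : T * C1 => yes (fst p) (snd p)) ->
  computable (fun p : T * C2 => no (fst p) (snd p)) ->
  (forall a c, Dom a -> yes (conv a) c = true -> P a) ->
  (forall a c, Dom a -> no (conv a) c = true -> ~ P a) ->
  (forall a, Dom a -> (exists c, yes (conv a) c = true) \/ (exists c, no (conv a) c = true)) ->
  decidable_on enc_a Dom P.
Proof.
  intros Hconv S1 S2 [y [Ry Hy]] [n [Rn Hn]] Sy Sn Cpl.
  assert (Rif : forall b f g, rm_computable b -> rm_computable f -> rm_computable g ->
    rm_computable (fun z => if b z =? 0 then f z else g z)).
  { intros b f g Hb Hf Hg.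
    assert (Hc : forall h, rm_computable h -> computable h) by (intros h ?; exists h; auto).
    destruct (cmp_if (fun z => b z =? 0) f g) as [h [Rh Eh]]; auto using cmp_zero.
    apply Rec_ext with h; auto. }
  destruct (Rec_search
    (fun x c => if y (cpair x c) =? 0 then if n (cpair x c) =? 0 then 1 else 0 else 0)
    (fun x c => if y (cpair x c) =? 0 then 0 else 1)) as [p Hp].
  1, 2: assert (Ry' : rm_computable (fun z => y (cpair (fst (unpair z)) (snd (unpair z)))))
    by (apply Rec_ext with y; auto; intros; now rewrite cpair_unpair);
    assert (Rn' : rm_computable (fun z => n (cpair (fst (unpair z)) (snd (unpair z)))))
    by (apply Rec_ext with n; auto; intros; now rewrite cpair_unpair);
    auto using Rec_const.
  exists p. intros a Da.
  assert (Ey : forall c, y (cpair (enc_a a) (enc c)) = enc (yes (conv a) c)).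
  { intros c. rewrite <- Hconv. exact (Hy (conv a, c)). }
  assert (En : forall c, n (cpair (enc_a a) (enc c)) = enc (no (conv a) c)).
  { intros c. rewrite <- Hconv. exact (Hn (conv a, c)). }
  destruct (Hp (enc_a a)) as (m & Hm & Hh).
  { destruct (Cpl a Da) as [[c Hc]|[c Hc]]; exists (enc c).
    - now rewrite Ey, Hc.
    - rewrite En, Hc. now destruct (y _ =? 0). }
  destruct (S1 m) as [c1 E1], (S2 m) as [c2 E2].
  pose proof (Ey c1) as Y. pose proof (En c2) as N. rewrite E1 in Y. rewrite E2 in N.
  rewrite Y, N in *. clear Y N.
  destruct (yes (conv a) c1) eqn:Y; simpl in *.
  - left. eauto.
  - right. destruct (no (conv a) c2) eqn:N; [eauto|discriminate].
Qed.

(** * Certificates for machines driven by their input languages *)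

Notation word := (list nat).
Notation tnfa := (nat * (list nat * (list nat * list (nat * (nat * nat)))))%type.
Notation ttrans := (nat * ((nat * (nat * nat)) * nat))%type.
Notation tinst := ((nat * (nat * (nat * (list nat * list ttrans)))) * list tnfa)%type.

(** Nested pairs replace records and actions so that the generic encoding applies. The nesting
    follows the given encodings, and therefore conversion does not change the code. *)
Definition conv_nfa (A : nfa) : tnfa :=
  (n_nstates A, (n_init A, (n_final A,
    map (fun t => match t with (p, a, q) => (p, (a, q)) end) (n_trans A)))).

Definition conv_trans (t : nat * action * nat) : ttrans :=
  match t with
  | (q, Send c a, q') => (q, ((0, (c, a)), q'))
  | (q, Recv c a, q') => (q, ((1, (c, a)), q'))
  end.

Definition conv (I : instance) : tinst :=
  let M := i_fifo I in
  ((f_nstates M, (f_init M, (f_nchan M, (f_alph M, map conv_trans (f_trans M))))),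
   map conv_nfa (i_langs I)).

Lemma enc_list_map_ext {A B} `{Enc B} (f : A -> B) (g : A -> nat) l :
  (forall x, enc (f x) = g x) -> enc (map f l) = enc_list (map g l).
Proof.
  intros E. change (enc (map f l)) with (enc_list (map enc (map f l))).
  rewrite map_map. f_equal. now apply map_ext.
Qed.

Lemma enc_nats (l : list nat) : enc l = enc_list l.
Proof.
  change (enc l) with (enc_list (map (fun n => n) l)). f_equal. apply map_id.
Qed.

Lemma enc_pair {A B} `{Enc A} `{Enc B} (a : A) (b : B) : enc (a, b) = cpair (enc a) (enc b).
Proof. reflexivity. Qed.

Lemma enc_conv_nfa A : enc (conv_nfa A) = enc_nfa A.
Proof.
  unfold conv_nfa, enc_nfa. rewrite !enc_pair, !enc_nats.
  do 3 f_equal.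
  apply (enc_list_map_ext _ enc_ntrans). now intros [[p a] q].
Qed.

Lemma enc_conv I : enc (conv I) = enc_instance I.
Proof.
  unfold conv, enc_instance, enc_fifo. rewrite !enc_pair, enc_nats.
  f_equal; [do 4 f_equal|].
  - apply (enc_list_map_ext _ enc_ftrans). now intros [[q [c a|c a]] q'].
  - apply (enc_list_map_ext _ enc_nfa), enc_conv_nfa.
Qed.

(* A state [(r, (q, (ws, Ps)))] consists of a clock [r], the control state [q], the channel
   contents [ws] and, for each channel, the set of states that its automaton can reach on
   the letters received so far.  Every step advances the clock by [m]: for [m = 0] the
   reachable states are finite in number iff the reachable configurations are, for [m = 1]
   iff the length of the executions is bounded. *)
Notation state := (nat * (nat * (list word * list (list nat))))%type.

Definition clock (st : state) : nat := fst st.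
Definition ctl (st : state) : nat := fst (snd st).
Definition chans (st : state) : list word := fst (snd (snd st)).
Definition sets (st : state) : list (list nat) := snd (snd (snd st)).

Definition langs (I : tinst) : list tnfa := snd I.
Definition initial (A : tnfa) : list nat := fst (snd A).
Definition finals (A : tnfa) : list nat := fst (snd (snd A)).
Definition edges (A : tnfa) : list (nat * (nat * nat)) := snd (snd (snd A)).
Definition nfa0 : tnfa := (0, ([], ([], []))).
Definition lang (I : tinst) (c : nat) : tnfa := nth c (langs I) nfa0.
Definition transitions (I : tinst) : list ttrans := snd (snd (snd (snd (fst I)))).

Definition mem (x : nat) (l : list nat) : bool := existsb (fun y => x =? y) l.

Definition delta (A : tnfa) (P : list nat) (a : nat) : list nat :=
  map (fun t => snd (snd t)) (filter (fun t => (fst (snd t) =? a) && mem (fst t) P) (edges A))%bool.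

Definition accepts (A : tnfa) (P : list nat) (u : word) : bool :=
  existsb (fun p => mem p (finals A)) (fold_left (fun P a => delta A P a) u P).

Definition set_nth (w : list (list nat)) (c : nat) (x : list nat) : list (list nat) :=
  map (fun i => if i =? c then x else nth i w []) (seq 0 (length w)).

Definition send (m : nat) (st : state) (t : ttrans) : state :=
  let c := fst (snd (fst (snd t))) in
  let a := snd (snd (fst (snd t))) in
  (clock st + m, (snd (snd t),
    (set_nth (chans st) c (nth c (chans st) [] ++ [a]), sets st))).

Definition receive (m : nat) (I : tinst) (st : state) (t : ttrans) : state :=
  let c := fst (snd (fst (snd t))) in
  let a := snd (snd (fst (snd t))) in
  (clock st + m, (snd (snd t),
    (set_nth (chans st) c (tl (nth c (chans st) [])),
     set_nth (sets st) c (delta (lang I c) (nth c (sets st) []) a)))).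

(** A list with at most one element stands for a partial function. Comparing the content with
    [a :: tl _] tests that [a] is at the head. *)
Definition fire (m : nat) (I : tinst) (st : state) (t : ttrans) : list state :=
  let c := fst (snd (fst (snd t))) in
  let a := snd (snd (fst (snd t))) in
  if fst t =? ctl st then
    if fst (fst (snd t)) =? 0 then [send m st t]
    else if eqe (nth c (chans st) []) (a :: tl (nth c (chans st) []))
         then [receive m I st t] else []
  else [].

Definition step (m : nat) (I : tinst) (st : state) (k : nat) : list state :=
  nth k (map (fire m I st) (transitions I)) [].

Definition run (m : nat) (I : tinst) (st : state) (ks : list nat) : list state :=
  fold_left (fun l k => flat_map (fun s => step m I s k) l) ks [st].

Definition start (I : tinst) : state :=
  (0, (fst (snd (fst I)), (map (fun _ => []) (langs I), map initial (langs I)))).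

Definition channels (I : tinst) : list nat := seq 0 (length (langs I)).

(* [F c] is to contain all states from which the automaton of channel [c] can accept. *)
Definition closed_back (I : tinst) (F : list (list nat)) : bool :=
  forallb (fun c =>
    forallb (fun p => mem p (nth c F [])) (finals (lang I c)) &&
    forallb (fun t => implb (mem (snd (snd t)) (nth c F [])) (mem (fst t) (nth c F [])))
      (edges (lang I c)))%bool (channels I).

Definition alive (I : tinst) (F : list (list nat)) (st : state) : bool :=
  forallb (fun c => existsb (fun p => mem p (nth c F [])) (nth c (sets st) [])) (channels I).

Definition mem_state (st : state) (S : list state) : bool := existsb (fun s => eqe st s) S.

(** The certificate brings its own [F], so no fixed point has to be computed. An [F] that is too
    large does not endanger soundness: it only forces more successors into the set. *)
Definition finite_cert (m : nat) (I : tinst) (C : list state * list (list nat)) : bool :=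
  (mem_state (start I) (fst C) && closed_back I (snd C) &&
   forallb (fun st =>
     forallb (fun st' => implb (alive I (snd C) st') (mem_state st' (fst C)))
       (flat_map (fire m I st) (transitions I))) (fst C))%bool.

Definition zip_app (ws zs : list word) : list word :=
  map (fun c => nth c ws [] ++ nth c zs []) (seq 0 (length ws)).

Definition accepting (I : tinst) (Ps us : list (list nat)) : bool :=
  forallb (fun c => accepts (lang I c) (nth c Ps []) (nth c us [])) (channels I).

(* Firing the loop [k2] twice appends the same words [zs] to the channels both times;
   by [pumping] below, it can then be fired forever. *)
Definition pump_cert (m : nat) (I : tinst)
    (C : list nat * (list nat * (list word * list word))) : bool :=
  let k1 := fst C in let k2 := fst (snd C) in
  let zs := fst (snd (snd C)) in let us := snd (snd (snd C)) in
  existsb (fun st => existsb (fun st' => existsb (fun st'' =>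
     negb (eqe st st') && (ctl st =? ctl st') && eqe (sets st) (sets st') &&
     eqe (chans st') (zip_app (chans st) zs) && eqe (chans st'') (zip_app (chans st') zs) &&
     accepting I (sets st) us)%bool
    (run m I st' k2)) (run m I st k2)) (run m I (start I) k1).

(** * Computability of the certificate tests *)

Section CertificateComputability.
Context (m : nat).

Lemma cmp_mem : computable (fun p : nat * list nat => mem (fst p) (snd p)).
Proof. unfold mem. cmp_auto. Qed.

Lemma cmp_delta :
  computable (fun p : tnfa * list nat * nat => delta (fst (fst p)) (snd (fst p)) (snd p)).
Proof. pose proof cmp_mem. unfold delta, edges. cmp_auto. Qed.

Lemma cmp_accepts :
  computable (fun p : tnfa * list nat * word => accepts (fst (fst p)) (snd (fst p)) (snd p)).
Proof. pose proof cmp_mem. pose proof cmp_delta. unfold accepts, finals. cmp_auto. Qed.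

Lemma cmp_lang : computable (fun p : tinst * nat => lang (fst p) (snd p)).
Proof. unfold lang, langs. cmp_auto. Qed.

Lemma cmp_set_nth :
  computable (fun p : list (list nat) * nat * list nat => set_nth (fst (fst p)) (snd (fst p)) (snd p)).
Proof. unfold set_nth. cmp_auto. Qed.

Lemma cmp_fire :
  computable (fun p : tinst * state * ttrans => fire m (fst (fst p)) (snd (fst p)) (snd p)).
Proof.
  pose proof cmp_set_nth. pose proof cmp_delta. pose proof cmp_lang.
  unfold fire, send, receive, clock, ctl, chans, sets. cbv zeta. cmp_auto.
Qed.

Lemma cmp_step :
  computable (fun p : tinst * state * nat => step m (fst (fst p)) (snd (fst p)) (snd p)).
Proof. pose proof cmp_fire. unfold step, transitions. cmp_auto. Qed.

Lemma cmp_run :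
  computable (fun p : tinst * state * list nat => run m (fst (fst p)) (snd (fst p)) (snd p)).
Proof. pose proof cmp_step. unfold run. cmp_auto. Qed.

Lemma cmp_start : computable start.
Proof. unfold start, langs, initial. cmp_auto. Qed.

Lemma cmp_closed_back : computable (fun p : tinst * list (list nat) => closed_back (fst p) (snd p)).
Proof.
  pose proof cmp_mem. pose proof cmp_lang.
  unfold closed_back, channels, langs, finals, edges. cmp_auto.
Qed.

Lemma cmp_alive :
  computable (fun p : tinst * list (list nat) * state => alive (fst (fst p)) (snd (fst p)) (snd p)).
Proof. pose proof cmp_mem. unfold alive, channels, langs, sets. cmp_auto. Qed.

Lemma cmp_mem_state : computable (fun p : state * list state => mem_state (fst p) (snd p)).
Proof. unfold mem_state. cmp_auto. Qed.

Lemma cmp_finite_cert :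
  computable (fun p : tinst * (list state * list (list nat)) => finite_cert m (fst p) (snd p)).
Proof.
  pose proof cmp_start. pose proof cmp_closed_back. pose proof cmp_alive.
  pose proof cmp_mem_state. pose proof cmp_fire.
  unfold finite_cert, transitions. cmp_auto.
Qed.

Lemma cmp_zip_app : computable (fun p : list word * list word => zip_app (fst p) (snd p)).
Proof. unfold zip_app. cmp_auto. Qed.

Lemma cmp_accepting :
  computable (fun p : tinst * list (list nat) * list (list nat) =>
         accepting (fst (fst p)) (snd (fst p)) (snd p)).
Proof.
  pose proof cmp_accepts. pose proof cmp_lang. unfold accepting, channels, langs. cmp_auto.
Qed.

Lemma cmp_pump_cert :
  computable (fun p : tinst * (list nat * (list nat * (list word * list word))) =>
         pump_cert m (fst p) (snd p)).
Proof.
  pose proof cmp_start. pose proof cmp_run. pose proof cmp_zip_app.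
  pose proof cmp_accepting. unfold pump_cert, ctl, sets, chans. cbv zeta. cmp_auto.
Qed.
End CertificateComputability.

(** * Automata *)

Notation dnfa := {| n_nstates := 0; n_init := []; n_final := []; n_trans := [] |}.

Lemma mem_spec x l : mem x l = true <-> In x l.
Proof.
  unfold mem. rewrite existsb_exists. split.
  - intros (y & Hy & E). apply Nat.eqb_eq in E. now subst.
  - intros H. exists x. split; auto. apply Nat.eqb_refl.
Qed.

Lemma in_edges A p a q : In (p, (a, q)) (edges (conv_nfa A)) <-> In (p, a, q) (n_trans A).
Proof.
  unfold edges, conv_nfa. simpl. rewrite in_map_iff. split.
  - intros ([[p' a'] q'] & E & H). now injection E as -> -> ->.
  - intros H. now exists (p, a, q).
Qed.

Lemma in_delta A P a q :
  In q (delta (conv_nfa A) P a) <-> exists p, In p P /\ In (p, a, q) (n_trans A).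
Proof.
  unfold delta. rewrite in_map_iff. split.
  - intros ([p [a' q']] & E & H). simpl in E. subst q'.
    apply filter_In in H as [H E]. simpl in E.
    apply andb_prop in E as [E1 E2]. apply Nat.eqb_eq in E1. subst a'.
    apply mem_spec in E2. apply in_edges in H. eauto.
  - intros (p & Hp & H). exists (p, (a, q)). split; auto.
    apply filter_In. rewrite in_edges. split; auto. simpl.
    rewrite Nat.eqb_refl. now apply mem_spec.
Qed.

Notation deltas A := (fold_left (fun P a => delta A P a)).

Lemma in_deltas A u P q :
  In q (deltas (conv_nfa A) u P) <-> exists p, In p P /\ nfa_path A p u q.
Proof.
  revert P. induction u as [|a u IH]; intros P; simpl.
  - split.
    + intros H. exists q. split; auto. constructor.
    + intros (p & Hp & H). now inversion H; subst.
  - rewrite IH. split.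
    + intros (p & Hp & H). apply in_delta in Hp as (p' & Hp' & Ht).
      exists p'. split; auto. econstructor; eauto.
    + intros (p & Hp & H). inversion H; subst. exists q0. split; auto.
      apply in_delta. eauto.
Qed.

Lemma accepts_spec A P u :
  accepts (conv_nfa A) P u = true <->
  exists p q, In p P /\ In q (n_final A) /\ nfa_path A p u q.
Proof.
  unfold accepts. rewrite existsb_exists. split.
  - intros (q & Hq & E). apply mem_spec in E. apply in_deltas in Hq as (p & Hp & H).
    exists p, q. auto.
  - intros (p & q & Hp & Hq & H). exists q. rewrite mem_spec, in_deltas. eauto.
Qed.

Lemma accepts_app A P u v :
  accepts A P (u ++ v) = accepts A (deltas A u P) v.
Proof. unfold accepts. now rewrite fold_left_app. Qed.

Lemma lang_conv I c : lang (conv I) c = conv_nfa (nth c (i_langs I) dnfa).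
Proof. exact (map_nth conv_nfa (i_langs I) dnfa c). Qed.

Lemma accepts_lang_of I c u :
  accepts (lang (conv I) c) (initial (lang (conv I) c)) u = true <-> lang_of I c u.
Proof.
  rewrite lang_conv, accepts_spec. unfold lang_of, nfa_lang, initial.
  split; intros (p & q & H); exists p, q; exact H.
Qed.

Lemma nfa_path_letters k A p u q :
  wf_nfa k A -> nfa_path A p u q -> Forall (fun a => a < k) u.
Proof.
  intros (_ & _ & W) H. induction H; constructor; auto. now apply W in H.
Qed.

(** * The state graph and the FIFO machine *)

Lemma set_nth_length w c x : length (set_nth w c x) = length w.
Proof. unfold set_nth. now rewrite length_map, length_seq. Qed.

Lemma nth_map_seq {A} (f : nat -> A) n i d :
  nth i (map f (seq 0 n)) d = if i <? n then f i else d.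
Proof.
  destruct (Nat.ltb_spec i n).
  - rewrite (nth_indep _ d (f 0)) by now rewrite length_map, length_seq.
    rewrite map_nth, seq_nth by auto. reflexivity.
  - apply nth_overflow. now rewrite length_map, length_seq.
Qed.

Lemma nth_set_nth w c x i :
  c < length w -> nth i (set_nth w c x) [] = if i =? c then x else nth i w [].
Proof.
  intros Hc. unfold set_nth. rewrite nth_map_seq.
  destruct (Nat.ltb_spec i (length w)); auto.
  destruct (Nat.eqb_spec i c); [lia|]. now rewrite nth_overflow.
Qed.

Lemma upd_chan_set_nth w c x : c < length w -> upd_chan w c x = set_nth w c x.
Proof.
  intros Hc. unfold upd_chan.
  assert (E : length (firstn c w) = c) by (rewrite length_firstn; lia).
  apply nth_ext with (d := []) (d' := []).
  - rewrite set_nth_length, length_app. cbn [length]. rewrite length_skipn, E. lia.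
  - intros i _. rewrite nth_set_nth by auto.
    destruct (Nat.eqb_spec i c) as [->|Hi].
    + rewrite app_nth2 by lia. now rewrite E, Nat.sub_diag.
    + destruct (Nat.lt_ge_cases i c).
      * rewrite app_nth1 by lia. rewrite nth_firstn.
        now destruct (Nat.ltb_spec i c); [|lia].
      * rewrite app_nth2 by lia. rewrite E.
        destruct (i - c) as [|d] eqn:Ed; [lia|]. cbn [nth].
        rewrite nth_skipn. f_equal. lia.
Qed.

Definition recd (c : nat) (b : action) : word :=
  match b with Recv c' a => if c' =? c then [a] else [] | Send _ _ => [] end.

Definition sent (c : nat) (b : action) : word :=
  match b with Send c' a => if c' =? c then [a] else [] | Recv _ _ => [] end.

Definition proj_send (c : nat) (sigma : list action) : word := flat_map (sent c) sigma.

Lemma proj_recv_cons c b s : proj_recv c (b :: s) = recd c b ++ proj_recv c s.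
Proof. reflexivity. Qed.

Lemma proj_send_cons c b s : proj_send c (b :: s) = sent c b ++ proj_send c s.
Proof. reflexivity. Qed.

Lemma proj_recv_app c s s' : proj_recv c (s ++ s') = proj_recv c s ++ proj_recv c s'.
Proof. apply flat_map_app. Qed.

Lemma proj_send_app c s s' : proj_send c (s ++ s') = proj_send c s ++ proj_send c s'.
Proof. apply flat_map_app. Qed.

(* The effect of an action on all channels, in a single equation for sends and receives. *)
Definition moves (w : list word) (b : action) (w' : list word) : Prop :=
  length w' = length w /\ forall c, recd c b ++ nth c w' [] = nth c w [] ++ sent c b.

Lemma moves_send w c a w' :
  c < length w -> (moves w (Send c a) w' <-> w' = set_nth w c (nth c w [] ++ [a])).
Proof.
  intros Hc. unfold moves, recd, sent. simpl. split.
  - intros [Hl H]. apply nth_ext with (d := []) (d' := []); [now rewrite set_nth_length|].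
    intros i _. rewrite H, nth_set_nth by auto. rewrite (Nat.eqb_sym i c).
    destruct (Nat.eqb_spec c i); [now subst|]. apply app_nil_r.
  - intros ->. rewrite set_nth_length. split; auto. intros i.
    rewrite nth_set_nth by auto. rewrite (Nat.eqb_sym i c).
    destruct (Nat.eqb_spec c i); [now subst|]. now rewrite app_nil_r.
Qed.

Lemma moves_recv w c a w' :
  c < length w ->
  (moves w (Recv c a) w' <->
   exists rest, nth c w [] = a :: rest /\ w' = set_nth w c rest).
Proof.
  intros Hc. unfold moves, recd, sent. simpl. split.
  - intros [Hl H]. exists (nth c w' []). split.
    + specialize (H c). rewrite Nat.eqb_refl, app_nil_r in H. now rewrite <- H.
    + apply nth_ext with (d := []) (d' := []); [now rewrite set_nth_length|].
      intros i _. rewrite nth_set_nth by auto. specialize (H i).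
      rewrite (Nat.eqb_sym c i) in H.
      destruct (Nat.eqb_spec i c); [now subst|]. now rewrite app_nil_r in H.
  - intros (rest & E & ->). rewrite set_nth_length. split; auto. intros i.
    rewrite nth_set_nth by auto. rewrite (Nat.eqb_sym i c).
    destruct (Nat.eqb_spec c i); [subst|]; now rewrite app_nil_r.
Qed.

Lemma fifo_step_spec M s b s' :
  (forall c a, b = Send c a \/ b = Recv c a -> c < length (snd s)) ->
  (fifo_step M s b s' <->
   In (fst s, b, fst s') (f_trans M) /\ moves (snd s) b (snd s')).
Proof.
  intros Hc. unfold fifo_step. destruct b as [c a|c a].
  - assert (c < length (snd s)) by (apply (Hc c a); auto).
    rewrite moves_send, <- upd_chan_set_nth by auto. tauto.
  - assert (H : c < length (snd s)) by (apply (Hc c a); auto).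
    rewrite moves_recv by auto.
    split; intros [Ht Hx]; split; auto.
    + destruct Hx as (_ & r & E1 & E2). exists r. now rewrite <- upd_chan_set_nth.
    + split; auto. destruct Hx as (r & E1 & E2). exists r.
      now rewrite upd_chan_set_nth.
Qed.

Definition act_of (t : ttrans) : action :=
  let b := fst (snd t) in
  if fst b =? 0 then Send (fst (snd b)) (snd (snd b)) else Recv (fst (snd b)) (snd (snd b)).

Definition act_chan (b : action) : nat := match b with Send c _ | Recv c _ => c end.

Definition sets_after (J : tinst) (Ps : list (list nat)) (b : action) : list (list nat) :=
  match b with
  | Send _ _ => Ps
  | Recv c a => set_nth Ps c (delta (lang J c) (nth c Ps []) a)
  end.

Lemma nth_sets_after J Ps b c :
  act_chan b < length Ps ->
  nth c (sets_after J Ps b) [] = deltas (lang J c) (recd c b) (nth c Ps []).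
Proof.
  intros Hc. destruct b as [c' a|c' a]; simpl in *; auto.
  rewrite nth_set_nth by auto. unfold recd.
  rewrite (Nat.eqb_sym c c'). destruct (Nat.eqb_spec c' c); subst; reflexivity.
Qed.

Lemma injective_word : @injective word _.
Proof. apply injective_list, injective_nat. Qed.

Lemma injective_words : @injective (list word) _.
Proof. apply injective_list, injective_word. Qed.

Lemma injective_state : @injective state _.
Proof. repeat apply injective_prod; auto using injective_nat, injective_words. Qed.

Lemma eqe_spec {A} `{Enc A} (x y : A) : @injective A _ -> (eqe x y = true <-> x = y).
Proof.
  intros HA. unfold eqe. rewrite Nat.eqb_eq. split; [apply HA|now intros ->].
Qed.

Section Instance.
Context (I : instance) (m : nat).
Notation J := (conv I).
Notation M := (i_fifo I).
Notation n := (f_nchan M).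

Definition shape (st : state) : Prop := length (chans st) = n /\ length (sets st) = n.

Definition cfg (st : state) : config := (ctl st, chans st).

Lemma fire_spec st t st' :
  shape st -> act_chan (act_of t) < n ->
  (In st' (fire m J st t) <->
   fst t = ctl st /\ snd (snd t) = ctl st' /\ clock st' = clock st + m /\
   moves (chans st) (act_of t) (chans st') /\
   sets st' = sets_after J (sets st) (act_of t)).
Proof.
  intros [Hw Hs] Hc. unfold fire. cbv zeta.
  destruct (Nat.eqb_spec (fst t) (ctl st)) as [Eq|Eq];
    [|simpl; split; [tauto|now intros [? _]]].
  unfold act_of, act_chan in *.
  destruct t as [q1 [[tag [c a]] q2]], st' as [r' [q' [ws' Ps']]]. cbn [fst snd] in *.
  unfold send, receive, clock, ctl, chans, sets in *. cbn [fst snd] in *.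
  destruct (tag =? 0); cbn [fst snd sets_after] in *.
  - rewrite moves_send by (now rewrite Hw). simpl. split.
    + intros [E|[]]. injection E as <- <- <- <-. auto.
    + intros (_ & -> & -> & -> & ->). auto.
  - rewrite moves_recv by (now rewrite Hw).
    set (w := nth c (fst (snd (snd st))) []) in *.
    destruct (eqe w (a :: tl w)) eqn:E.
    + apply (eqe_spec _ _ injective_word) in E. simpl. split.
      * intros [F|[]]. injection F as <- <- <- <-. repeat split; auto. eauto.
      * intros (_ & -> & -> & (r & F & ->) & ->). rewrite F. auto.
    + split; [intros []|]. intros (_ & _ & _ & (r & F & _) & _).
      rewrite F in E. simpl in E.
      assert (X : eqe (a :: r) (a :: r) = true) by now apply (eqe_spec _ _ injective_word).
      congruence.
Qed.

Lemma sets_after_length Ps b : length (sets_after J Ps b) = length Ps.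
Proof. destruct b; simpl; auto using set_nth_length. Qed.

Lemma state_ext st st' :
  shape st -> shape st' -> clock st = clock st' -> ctl st = ctl st' -> sets st = sets st' ->
  (forall c, c < n -> nth c (chans st) [] = nth c (chans st') []) -> st = st'.
Proof.
  intros [H1 _] [H2 _] E1 E2 E3 E4.
  assert (E5 : chans st = chans st').
  { apply nth_ext with (d := []) (d' := []); [congruence|]. intros c Hc.
    apply E4. congruence. }
  destruct st as [r [q [ws Ps]]], st' as [r' [q' [ws' Ps']]].
  unfold clock, ctl, chans, sets in *. simpl in *. congruence.
Qed.

Inductive trun : state -> list ttrans -> state -> Prop :=
| trun_nil st : trun st [] st
| trun_cons st t st1 ts st2 :
    In t (transitions J) -> In st1 (fire m J st t) -> trun st1 ts st2 ->
    trun st (t :: ts) st2.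

Lemma trun_app st ts st1 ts' st2 :
  trun st ts st1 -> trun st1 ts' st2 -> trun st (ts ++ ts') st2.
Proof. induction 1; simpl; auto. intros. econstructor; eauto. Qed.

Lemma run_fold_app l1 l2 ks :
  fold_left (fun l k => flat_map (fun s => step m J s k) l) ks (l1 ++ l2) =
  fold_left (fun l k => flat_map (fun s => step m J s k) l) ks l1 ++
  fold_left (fun l k => flat_map (fun s => step m J s k) l) ks l2.
Proof.
  revert l1 l2. induction ks as [|k ks IH]; intros l1 l2; simpl; auto.
  now rewrite flat_map_app, IH.
Qed.

Lemma in_run_cons st k ks st' :
  In st' (run m J st (k :: ks)) <-> exists st1, In st1 (step m J st k) /\ In st' (run m J st1 ks).
Proof.
  unfold run. simpl. rewrite app_nil_r.
  induction (step m J st k) as [|s l IH].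
  - split.
    + replace (fold_left _ ks []) with (@nil state); [intros []|].
      clear. induction ks; simpl; auto.
    + intros (? & [] & _).
  - change (s :: l) with ([s] ++ l). rewrite run_fold_app, in_app_iff, IH. split.
    + intros [H|(s1 & H1 & H2)]; [exists s|exists s1]; simpl; auto.
    + intros (s1 & [H1|H1] & H2); [left; now subst|right; eauto].
Qed.

Definition default_trans : ttrans := (0, ((0, (0, 0)), 0)).

Lemma run_trun st ks st' :
  In st' (run m J st ks) -> trun st (map (fun k => nth k (transitions J) default_trans) ks) st'.
Proof.
  revert st. induction ks as [|k ks IH]; intros st.
  - simpl. intros [->|[]]. constructor.
  - rewrite in_run_cons. intros (st1 & H1 & H2). simpl. unfold step in H1.
    destruct (Nat.lt_ge_cases k (length (transitions J))) as [Hk|Hk].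
    + rewrite (nth_indep _ [] (fire m J st default_trans)) in H1
        by now rewrite length_map.
      rewrite map_nth in H1.
      apply trun_cons with st1; auto using nth_In.
    + rewrite nth_overflow in H1 by now rewrite length_map. destruct H1.
Qed.

(** The indices depend on the transitions alone and serve from every starting state, as is needed
    for the two rounds of a loop in [pump_cert]. *)
Lemma trun_run ts :
  Forall (fun t => In t (transitions J)) ts ->
  exists ks, forall st st', trun st ts st' -> In st' (run m J st ks).
Proof.
  induction 1 as [|t ts Ht _ (ks & IH)].
  - exists []. intros st st' H. inversion H; subst. now left.
  - apply (In_nth _ _ default_trans) in Ht as (k & Hk & E).
    exists (k :: ks). intros st st' H. inversion H; subst.
    rewrite in_run_cons. exists st1. split; auto. unfold step.
    rewrite (nth_indep _ [] (fire m J st default_trans)) by now rewrite length_map.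
    now rewrite map_nth.
Qed.

Lemma trun_transitions st ts st' : trun st ts st' -> Forall (fun t => In t (transitions J)) ts.
Proof. induction 1; constructor; auto. Qed.

(** Continuations can be chosen for each channel separately, because [L_recv] constrains each
    projection on its own. They need not be executable, since [Pref] speaks of words only. *)
Definition live (st : state) : Prop :=
  exists us, forall c, c < n -> accepts (lang J c) (nth c (sets st) []) (nth c us []) = true.

Context (WF : wf_instance I).

Lemma length_langs : length (langs J) = n.
Proof.
  destruct WF as (_ & E & _). unfold langs, conv. simpl. now rewrite length_map.
Qed.

Lemma transitions_spec t :
  In t (transitions J) <-> In (fst t, act_of t, snd (snd t)) (f_trans M) /\ fst (fst (snd t)) <= 1.
Proof.
  unfold transitions, conv. cbn [fst snd]. rewrite in_map_iff. split.
  - intros ([[q [c a|c a]] q'] & <- & H); simpl; auto.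
  - intros [H L]. exists (fst t, act_of t, snd (snd t)). split; auto.
    destruct t as [q [[[|[|tag]] [c a]] q']]; simpl in *; auto; lia.
Qed.

Lemma transitions_chan t : In t (transitions J) -> act_chan (act_of t) < n.
Proof.
  intros H. apply transitions_spec in H as [H _].
  destruct WF as ((_ & _ & W) & _). apply W in H as (_ & _ & H).
  destruct (act_of t); apply H.
Qed.

Lemma transitions_valid t : In t (transitions J) -> valid_action M (act_of t).
Proof.
  intros H. apply transitions_spec in H as [H _].
  destruct WF as ((_ & _ & W) & _). now apply W in H as (_ & _ & H).
Qed.

Lemma fire_shape st t st' :
  shape st -> In t (transitions J) -> In st' (fire m J st t) -> shape st'.
Proof.
  intros Hs Ht H. apply fire_spec in H; auto using transitions_chan.
  destruct H as (_ & _ & _ & [H1 _] & H2), Hs as [S1 S2].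
  split; [congruence|]. rewrite H2, sets_after_length. auto.
Qed.

Lemma trun_shape st ts st' : shape st -> trun st ts st' -> shape st'.
Proof. intros Hs H. induction H; auto. apply IHtrun. eapply fire_shape; eauto. Qed.

Lemma fire_sets st t st' c :
  shape st -> In t (transitions J) -> In st' (fire m J st t) ->
  nth c (sets st') [] = deltas (lang J c) (recd c (act_of t)) (nth c (sets st) []).
Proof.
  intros Hs Ht H. pose proof (transitions_chan _ Ht) as Hc.
  apply fire_spec in H; auto. destruct H as (_ & _ & _ & _ & ->).
  apply nth_sets_after. destruct Hs as [_ ->]. auto.
Qed.

Lemma trun_sets st ts st' c :
  shape st -> trun st ts st' ->
  nth c (sets st') [] = deltas (lang J c) (proj_recv c (map act_of ts)) (nth c (sets st) []).
Proof.
  intros Hs H. induction H as [|st t st1 ts st2 Ht H1 H IH]; auto.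
  cbn [map]. rewrite proj_recv_cons, fold_left_app, IH by eauto using fire_shape.
  f_equal. now apply fire_sets.
Qed.

(** The FIFO law, from which the later word equations come: letters leave a channel in the order in
    which they were stored and sent. *)
Lemma trun_chans st ts st' c :
  shape st -> trun st ts st' ->
  proj_recv c (map act_of ts) ++ nth c (chans st') [] =
  nth c (chans st) [] ++ proj_send c (map act_of ts).
Proof.
  intros Hs H. induction H as [|st t st1 ts st2 Ht H1 H IH]; [now rewrite app_nil_r|].
  cbn [map]. rewrite proj_recv_cons, proj_send_cons, <- app_assoc, IH by eauto using fire_shape.
  apply fire_spec in H1; auto using transitions_chan.
  destruct H1 as (_ & _ & _ & [_ E] & _).
  rewrite !app_assoc. now rewrite E.
Qed.

Lemma trun_clock st ts st' :
  shape st -> trun st ts st' -> clock st' = clock st + length ts * m.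
Proof.
  intros Hs H. induction H as [|st t st1 ts st2 Ht H1 H IH]; [simpl; lia|].
  rewrite IH by eauto using fire_shape. apply fire_spec in H1; auto using transitions_chan.
  simpl. lia.
Qed.

Lemma shape_start : shape (start J).
Proof.
  unfold shape, start, chans, sets. cbn [fst snd]. now rewrite !length_map, length_langs.
Qed.

Lemma chans_start c : nth c (chans (start J)) [] = [].
Proof.
  unfold start, chans. cbn [fst snd]. exact (map_nth (fun _ => []) (langs J) nfa0 c).
Qed.

Lemma sets_start c : nth c (sets (start J)) [] = initial (lang J c).
Proof.
  unfold start, sets, lang. cbn [fst snd].
  exact (map_nth initial (langs J) nfa0 c).
Qed.

Lemma cfg_start : cfg (start J) = init_config M.
Proof.
  unfold cfg, init_config. f_equal.
  pose proof length_langs as L. unfold start, chans. cbn [fst snd]. rewrite <- L.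
  clear. induction (langs J); simpl; congruence.
Qed.

Lemma fire_fifo_step st t st' :
  shape st -> In t (transitions J) -> In st' (fire m J st t) ->
  fifo_step M (cfg st) (act_of t) (cfg st').
Proof.
  intros Hs Ht H. pose proof (transitions_chan _ Ht) as Hc.
  apply fire_spec in H as (E1 & E2 & _ & Hm & _); auto.
  apply fifo_step_spec.
  - intros c a Ha. destruct Hs as [E _]. simpl. rewrite E.
    destruct Ha as [Ha|Ha]; rewrite Ha in Hc; exact Hc.
  - split; auto. simpl. rewrite <- E1, <- E2. now apply transitions_spec.
Qed.

Lemma fifo_step_fire st b s' :
  shape st -> fifo_step M (cfg st) b s' ->
  exists t st', In t (transitions J) /\ In st' (fire m J st t) /\ cfg st' = s' /\ act_of t = b.
Proof.
  intros Hs H. assert (Hf := proj1 H).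
  assert (Hc : act_chan b < n).
  { destruct WF as ((_ & _ & W) & _). apply W in Hf as (_ & _ & Hf).
    destruct b; apply Hf. }
  apply fifo_step_spec in H as [_ Hm].
  2: { intros c a E. destruct Hs as [Hs _]. simpl. rewrite Hs.
       destruct E; subst b; exact Hc. }
  destruct s' as [q' w']. simpl in *.
  set (t := conv_trans (ctl st, b, q')).
  assert (Eb : act_of t = b) by (unfold t; destruct b; reflexivity).
  exists t, (clock st + m, (q', (w', sets_after J (sets st) b))).
  assert (Ht : In t (transitions J)).
  { unfold transitions, conv. cbn [fst snd]. apply in_map. exact Hf. }
  repeat split; auto.
  apply fire_spec; auto; [now rewrite Eb|].
  rewrite Eb. repeat split; auto; try apply Hm; unfold t; destruct b; reflexivity.
Qed.

Lemma trun_fifo_reach st ts st' :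
  shape st -> trun st ts st' -> fifo_reach M (cfg st) (map act_of ts) (cfg st').
Proof.
  intros Hs H. induction H as [|st t st1 ts st2 Ht H1 H IH]; [constructor|].
  simpl. econstructor; [eapply fire_fifo_step; eauto|]. eauto using fire_shape.
Qed.

Lemma fifo_reach_trun s sigma s' :
  fifo_reach M s sigma s' -> forall st, shape st -> cfg st = s ->
  exists ts st', trun st ts st' /\ cfg st' = s' /\ map act_of ts = sigma.
Proof.
  induction 1 as [s|s b s1 sigma s2 H1 H IH]; intros st Hs <-.
  - exists [], st. repeat split; constructor.
  - apply fifo_step_fire in H1 as (t & st1 & Ht & Hf & <- & <-); auto.
    destruct (IH st1) as (ts & st2 & H2 & <- & <-); eauto using fire_shape.
    exists (t :: ts), st2. repeat split; auto. econstructor; eauto.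
Qed.

(** Computes the projections of the continuation built in [live_pref], which receives the missing
    words one channel after another. *)
Lemma proj_recv_concat (u : nat -> word) c k s :
  proj_recv c (flat_map (fun i => map (Recv i) (u i)) (seq s k)) =
  if ((s <=? c) && (c <? s + k))%bool then u c else [].
Proof.
  revert s. induction k as [|k IH]; intros s; simpl.
  - destruct (Nat.leb_spec s c), (Nat.ltb_spec c (s + 0)); simpl; auto; lia.
  - rewrite proj_recv_app, IH.
    assert (E : proj_recv c (map (Recv s) (u s)) = if s =? c then u s else []).
    { induction (u s) as [|a v IHv]; simpl; [now destruct (s =? c)|].
      rewrite IHv. now destruct (s =? c). }
    rewrite E.
    destruct (Nat.eqb_spec s c), (Nat.leb_spec s c), (Nat.ltb_spec c (s + S k)),
      (Nat.leb_spec (S s) c), (Nat.ltb_spec c (S s + k)); simpl; subst;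
      rewrite ?app_nil_r; auto; lia.
Qed.

Lemma live_pref ts st :
  trun (start J) ts st -> live st -> Pref (L_recv I) (map act_of ts).
Proof.
  intros H [us Hu].
  exists (flat_map (fun c => map (Recv c) (nth c us [])) (seq 0 n)). split.
  - apply Forall_app. split.
    + apply Forall_map. eapply Forall_impl; [|eapply trun_transitions, H].
      apply transitions_valid.
    (* The missing words label automaton paths, so their letters belong to the alphabet of the
       channel. *)
    + apply Forall_flat_map, Forall_forall. intros c Hc. apply in_seq in Hc.
      apply Forall_map, Forall_forall. intros a Ha. simpl. split; [lia|].
      specialize (Hu c ltac:(lia)). rewrite lang_conv in Hu.
      apply accepts_spec in Hu as (p & q & _ & _ & Hp).
      destruct WF as (_ & _ & W). destruct (W c) as (Wc & _ & _); [lia|].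
      eapply nfa_path_letters in Hp; [|exact Wc].
      rewrite Forall_forall in Hp. auto.
  - intros c Hc. apply accepts_lang_of.
    rewrite proj_recv_app, accepts_app, <- sets_start.
    rewrite <- (trun_sets _ _ _ c shape_start H), proj_recv_concat.
    destruct (Nat.ltb_spec c (0 + n)); [|lia]. simpl. auto.
Qed.

Lemma pref_live ts st :
  trun (start J) ts st -> Pref (L_recv I) (map act_of ts) -> live st.
Proof.
  intros H (tau & _ & Hl).
  exists (map (fun c => proj_recv c tau) (seq 0 n)). intros c Hc.
  rewrite nth_map_seq. destruct (Nat.ltb_spec c n); [|lia].
  rewrite (trun_sets _ _ _ c shape_start H), sets_start, <- accepts_app, <- proj_recv_app.
  now apply accepts_lang_of, Hl.
Qed.

(** The letters received on the way, put in front of a continuation of the later state, form one of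
    the earlier state. *)
Lemma trun_live st ts st' : shape st -> trun st ts st' -> live st' -> live st.
Proof.
  intros Hs H [us Hu].
  exists (map (fun c => proj_recv c (map act_of ts) ++ nth c us []) (seq 0 n)).
  intros c Hc. rewrite nth_map_seq. destruct (Nat.ltb_spec c n); [|lia].
  rewrite accepts_app, <- (trun_sets _ _ _ c Hs H). auto.
Qed.

End Instance.

(** * Soundness of the certificates *)

(** Pushes a surplus [z] past the letters [s] sent by one action; what comes out is again to be
    pushed past the remaining sends [x]. *)
Lemma app_split {A} (z s x y : list A) :
  z ++ s ++ x = s ++ y -> z ++ s = s ++ skipn (length s) (z ++ s) /\
                          skipn (length s) (z ++ s) ++ x = y.
Proof.
  intros E. rewrite app_assoc in E.
  assert (F : firstn (length s) (z ++ s) = s).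
  { apply (f_equal (firstn (length s))) in E.
    rewrite !firstn_app, length_app, Nat.sub_diag, firstn_O, firstn_all in E.
    replace (length s - (length z + length s)) with 0 in E by lia.
    rewrite firstn_O, !app_nil_r in E. now rewrite firstn_app. }
  assert (G : z ++ s = s ++ skipn (length s) (z ++ s)).
  { rewrite <- F at 2. symmetry. apply firstn_skipn. }
  split; auto. rewrite G, <- app_assoc in E. now apply app_inv_head in E.
Qed.

Definition pow (z : word) (k : nat) : word := concat (repeat z k).

Lemma pow_comm z s k : z ++ s = s ++ z -> pow z k ++ s = s ++ pow z k.
Proof.
  intros E. induction k as [|k IH]; unfold pow in *; simpl; [now rewrite app_nil_r|].
  now rewrite <- app_assoc, IH, app_assoc, E, <- app_assoc.
Qed.

Lemma pow_length z k : length (pow z k) = k * length z.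
Proof. unfold pow. induction k; simpl; auto. rewrite length_app. lia. Qed.

Lemma not_in_list_of_unbounded {A} (f : nat -> A) (l : list A) :
  (forall i j, f i = f j -> i = j) -> ~ (forall i, In (f i) l).
Proof.
  intros Inj H.
  assert (L : length (map f (seq 0 (S (length l)))) <= length l).
  { apply NoDup_incl_length.
    - apply FinFun.Injective_map_NoDup; [exact Inj|apply seq_NoDup].
    - intros x Hx. apply in_map_iff in Hx as (i & <- & _). apply H. }
  rewrite length_map, length_seq in L. lia.
Qed.

(** Carrying the proof of [Q] in a subset type makes the chosen successor a total function, which
    can be iterated. *)
Lemma dependent_choice {A} (Q : A -> Prop) (R : A -> A -> Prop) x0 :
  Q x0 -> (forall x, Q x -> exists y, Q y /\ R x y) ->
  exists f : nat -> A, f 0 = x0 /\ forall i, Q (f i) /\ R (f i) (f (S i)).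
Proof.
  intros H0 H.
  assert (H' : forall x : {x | Q x}, {y : {y | Q y} | R (proj1_sig x) (proj1_sig y)}).
  { intros [x Hx]. apply constructive_indefinite_description.
    destruct (H x Hx) as (y & Hy & Hr). now exists (exist _ y Hy). }
  exists (fun i => proj1_sig (Nat.iter i (fun x => proj1_sig (H' x)) (exist _ x0 H0))).
  split; auto. intros i. split.
  - apply proj2_sig.
  - rewrite Nat.iter_succ. apply (proj2_sig (H' _)).
Qed.

Section Soundness.
Context (I : instance) (m : nat) (WF : wf_instance I).
Notation J := (conv I).
Notation M := (i_fifo I).
Notation n := (f_nchan M).
Notation shape := (shape I).
Notation trun := (trun I m).

(** A surplus behind each content does not disturb receives, provided that it can be shifted past
    the letters sent during the run. The hypothesis on [z] and [z2] allows the shift for the whole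
    run, and [app_split] performs it action by action. *)
Lemma trun_append st ts st' st2 (z z2 : nat -> word) :
  shape st -> trun st ts st' ->
  shape st2 -> ctl st2 = ctl st -> sets st2 = sets st ->
  (forall c, nth c (chans st2) [] = nth c (chans st) [] ++ z c) ->
  (forall c, z c ++ proj_send c (map act_of ts) = proj_send c (map act_of ts) ++ z2 c) ->
  exists st2', trun st2 ts st2' /\ ctl st2' = ctl st' /\ sets st2' = sets st' /\
    forall c, nth c (chans st2') [] = nth c (chans st') [] ++ z2 c.
Proof.
  intros Hs H. revert st2 z.
  induction H as [st|st t st1 ts st' Ht H1 H IH]; intros st2 z Hs2 Ec Es Ew Ez.
  - exists st2. repeat split; auto; [constructor|]. intros c. rewrite Ew.
    specialize (Ez c). simpl in Ez. rewrite app_nil_r in Ez. now rewrite Ez.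
  - set (b := act_of t) in *.
    assert (Hc : act_chan b < n) by now apply (transitions_chan I WF).
    set (z1 := fun c => skipn (length (sent c b)) (z c ++ sent c b)).
    assert (Hz : forall c, z c ++ sent c b = sent c b ++ z1 c /\
      z1 c ++ proj_send c (map act_of ts) = proj_send c (map act_of ts) ++ z2 c).
    { intros c. apply app_split. specialize (Ez c). cbn [map] in Ez.
      rewrite proj_send_cons, <- app_assoc in Ez. exact Ez. }
    pose proof (fire_shape I m WF _ _ _ Hs Ht H1) as Hs1.
    apply fire_spec in H1 as (E1 & E2 & E3 & [_ E4] & E5); auto.
    set (st3 := (clock st2 + m, (ctl st1,
      (map (fun c => nth c (chans st1) [] ++ z1 c) (seq 0 n), sets st1))) : state).
    assert (W3 : forall c, nth c (chans st3) [] = nth c (chans st1) [] ++ z1 c).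
    { intros c. change (chans st3) with (map (fun c => nth c (chans st1) [] ++ z1 c) (seq 0 n)).
      rewrite nth_map_seq. destruct (Nat.ltb_spec c n) as [L|L]; auto.
      (* Beyond the last channel all contents read as empty, which forces [z c] and hence [z1 c] to
         be empty. *)
      specialize (Ew c). destruct Hs1 as [L1 _], Hs as [L0 _], Hs2 as [L2 _].
      rewrite !nth_overflow in Ew by congruence. specialize (E4 c).
      rewrite !nth_overflow in E4 by congruence. rewrite nth_overflow by congruence.
      destruct (Hz c) as [Hz' _]. simpl in Ew, E4. rewrite app_nil_r in E4.
      rewrite <- Ew in Hz'. unfold z1. rewrite <- Ew. simpl.
      rewrite skipn_all. reflexivity. }
    assert (S3 : shape st3).
    { split; [|apply Hs1]. unfold chans, st3. cbn [fst snd]. now rewrite length_map, length_seq. }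
    destruct (IH Hs1 st3 z1) as (st2' & R & F1 & F2 & F3); auto.
    { intros c. apply Hz. }
    exists st2'. repeat split; auto. econstructor; eauto.
    apply fire_spec; auto. repeat split.
    + now rewrite Ec.
    + exact E2.
    + destruct S3 as [-> _], Hs2 as [-> _]. reflexivity.
    + intros c. rewrite W3, Ew, app_assoc, E4, <- !app_assoc. f_equal.
      symmetry. apply Hz.
    + rewrite Es. exact E5.
Qed.

(** * Repeating a loop whose surplus commutes with its sends *)

Section Pump.
Context (st st' : state) (ts : list ttrans) (z : nat -> word).
Context (Hs : shape st) (Hr : trun st ts st') (Hctl : ctl st' = ctl st)
  (Hsets : sets st' = sets st)
  (Hw : forall c, nth c (chans st') [] = nth c (chans st) [] ++ z c)
  (Hz : forall c, z c ++ proj_send c (map act_of ts) = proj_send c (map act_of ts) ++ z c).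

Definition pumped (k : nat) : state :=
  (clock st + k * (length ts * m), (ctl st,
    (map (fun c => nth c (chans st) [] ++ pow (z c) k) (seq 0 n), sets st))).

Lemma pumped_shape k : shape (pumped k).
Proof.
  split; [|apply Hs]. unfold pumped, chans. cbn [fst snd]. now rewrite length_map, length_seq.
Qed.

Lemma pumped_chans k c :
  nth c (chans (pumped k)) [] = nth c (chans st) [] ++ pow (z c) k.
Proof.
  change (chans (pumped k)) with (map (fun c => nth c (chans st) [] ++ pow (z c) k) (seq 0 n)).
  rewrite nth_map_seq. destruct (Nat.ltb_spec c n) as [L|L]; auto.
  specialize (Hw c). pose proof (trun_shape I m WF _ _ _ Hs Hr) as [L' _].
  destruct Hs as [L0 _]. rewrite !nth_overflow in Hw by congruence.
  rewrite nth_overflow by congruence. simpl in Hw. rewrite <- Hw.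
  symmetry. apply length_zero_iff_nil. simpl. rewrite pow_length. simpl. lia.
Qed.

(** Powers of [z] commute with the word sent because [z] does. So [z^k] passes through the round
    unchanged, behind the new [z] that the round itself appends. *)
Lemma pumping k : trun (pumped k) ts (pumped (S k)).
Proof.
  destruct (trun_append st ts st' (pumped k) (fun c => pow (z c) k) (fun c => pow (z c) k))
    as (s & R & F1 & F2 & F3); auto using pumped_shape, pumped_chans, pow_comm.
  replace (pumped (S k)) with s; auto. apply (state_ext I).
  - exact (trun_shape I m WF _ _ _ (pumped_shape k) R).
  - apply pumped_shape.
  - rewrite (trun_clock I m WF _ _ _ (pumped_shape k) R). unfold pumped, clock. simpl. lia.
  - rewrite F1. exact Hctl.
  - rewrite F2. exact Hsets.
  - intros c _. rewrite F3, Hw, pumped_chans, <- app_assoc. reflexivity.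
Qed.

Lemma pumped_0 : pumped 0 = st.
Proof.
  apply (state_ext I); auto using pumped_shape.
  intros c _. rewrite pumped_chans. apply app_nil_r.
Qed.
End Pump.

Lemma zip_app_chans ws zs c :
  length ws = n -> nth c (zip_app ws zs) [] = if c <? n then nth c ws [] ++ nth c zs [] else [].
Proof. intros E. unfold zip_app. now rewrite nth_map_seq, E. Qed.

(** Commutation is not tested but follows from the two rounds. Let each receive [v] and send [u],
    starting from content [w]: the FIFO law gives [v w z = w u] and [v w z z = w z u], hence
    [w u z = w z u]. *)
Lemma pump_cert_loop C :
  pump_cert m J C = true ->
  exists ts0 ts st st' z, trun (start J) ts0 st /\ trun st ts st' /\ st <> st' /\
    ctl st' = ctl st /\ sets st' = sets st /\
    (forall c, nth c (chans st') [] = nth c (chans st) [] ++ z c) /\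
    (forall c, z c ++ proj_send c (map act_of ts) = proj_send c (map act_of ts) ++ z c) /\
    live I st.
Proof.
  unfold pump_cert. cbv zeta. intros H.
  apply existsb_exists in H as (st & R0 & H).
  apply existsb_exists in H as (st' & R1 & H).
  apply existsb_exists in H as (st'' & R2 & H).
  repeat match goal with H : (_ && _)%bool = true |- _ => apply andb_prop in H as [H ?] end.
  destruct C as (k1 & k2 & zs & us). cbn [fst snd] in *.
  apply run_trun in R0, R1, R2. set (ts := map _ k2) in *.
  repeat match goal with
  | H : eqe (sets _) _ = true |- _ => apply (eqe_spec _ _ injective_words) in H
  | H : eqe (chans _) _ = true |- _ => apply (eqe_spec _ _ injective_words) in H
  | H : (_ =? _) = true |- _ => apply Nat.eqb_eq in H
  end.
  pose proof (trun_shape I m WF _ _ _ (shape_start I WF) R0) as S0.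
  pose proof (trun_shape I m WF _ _ _ S0 R1) as S1.
  (* Cut off at [n], because the list [zs] of the certificate may be longer than the list of
     channels. *)
  set (z := fun c => if c <? n then nth c zs [] else []).
  assert (Ez : forall s s', shape s -> chans s' = zip_app (chans s) zs ->
    forall c, nth c (chans s') [] = nth c (chans s) [] ++ z c).
  { intros s s' [L _] -> c. rewrite zip_app_chans by auto. unfold z.
    destruct (Nat.ltb_spec c n); auto. now rewrite nth_overflow by congruence. }
  match goal with H : chans st' = _ |- _ => pose proof (Ez _ _ S0 H) as E1 end.
  match goal with H : chans st'' = _ |- _ => pose proof (Ez _ _ S1 H) as E2 end.
  eexists _, ts, st, st', z. repeat split; eauto.
  - intros ->. apply Bool.negb_true_iff in H.
    rewrite (proj2 (eqe_spec st' st' injective_state) eq_refl) in H. discriminate.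
  - intros c. pose proof (trun_chans I m WF _ _ _ c S0 R1) as F1.
    pose proof (trun_chans I m WF _ _ _ c S1 R2) as F2.
    rewrite E2, E1, app_assoc in F2. rewrite E1 in F1. rewrite F1 in F2.
    rewrite <- !app_assoc in F2. apply app_inv_head in F2. now symmetry.
  - exists us. intros c Hc.
    match goal with H : accepting _ _ _ = true |- _ => unfold accepting in H;
      rewrite forallb_forall in H; apply H end.
    unfold channels. rewrite (length_langs I WF). apply in_seq. lia.
Qed.

Lemma trun_pumped st st' ts z :
  shape st -> trun st ts st' -> ctl st' = ctl st -> sets st' = sets st ->
  (forall c, nth c (chans st') [] = nth c (chans st) [] ++ z c) ->
  (forall c, z c ++ proj_send c (map act_of ts) = proj_send c (map act_of ts) ++ z c) ->
  forall k, exists ts', trun st ts' (pumped st ts z k).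
Proof.
  intros Hs Hr Hc He Hw Hz. induction k as [|k (ts' & IH)].
  - exists []. erewrite pumped_0; eauto. constructor.
  - exists (ts' ++ ts). eapply trun_app; eauto. eapply pumping; eauto.
Qed.

Lemma live_pumped st ts z k : live I st -> live I (pumped st ts z k).
Proof. intros [us Hu]. exists us. exact Hu. Qed.

(** With a frozen clock the two distinct states of the loop can differ only in a channel. Its
    surplus is therefore nonempty, and the lengths of its contents tell the pumped configurations
    apart. *)
Lemma pump_cert_unbounded C : m = 0 -> pump_cert m J C = true -> OB_unbounded I.
Proof.
  intros Hm H [l Hl].
  apply pump_cert_loop in H
    as (ts0 & ts & st & st' & z & R0 & R & Hne & Hc & He & Hw & Hz & L).
  pose proof (trun_shape I m WF _ _ _ (shape_start I WF) R0) as S0.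
  pose proof (trun_shape I m WF _ _ _ S0 R) as S1.
  assert (Hz0 : exists c, z c <> []).
  { apply NNPP. intros Hno. apply Hne, (state_ext I); auto.
    - rewrite (trun_clock I m WF _ _ _ S0 R). lia.
    - intros c _. rewrite Hw. destruct (z c) eqn:E; [now rewrite app_nil_r|].
      exfalso. apply Hno. exists c. now rewrite E. }
  destruct Hz0 as [c Hc0].
  apply (not_in_list_of_unbounded (fun k => cfg (pumped st ts z k)) l).
  - intros i j E. apply (f_equal snd) in E. simpl in E.
    apply (f_equal (fun w => length (nth c w []))) in E.
    change (length (nth c (chans (pumped st ts z i)) []) =
            length (nth c (chans (pumped st ts z j)) [])) in E.
    erewrite !pumped_chans in E by eauto.
    rewrite !length_app, !pow_length in E. destruct (z c); [easy|]. simpl in E. nia.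
  - intros k. apply Hl. destruct (trun_pumped _ _ _ _ S0 R Hc He Hw Hz k) as [ts' R'].
    exists (map act_of (ts0 ++ ts')).
    pose proof (trun_app I m _ _ _ _ _ R0 R') as R''. split.
    + eapply live_pref; eauto using live_pumped.
    + rewrite <- (cfg_start I WF). eapply trun_fifo_reach; eauto using shape_start.
Qed.

Lemma infinite_run (Q : state -> Prop) s0 :
  Q s0 -> (forall s, Q s -> exists t s', In t (transitions J) /\ In s' (fire m J s t) /\ Q s') ->
  exists (s : nat -> state) (t : nat -> ttrans), s 0 = s0 /\
    forall i, Q (s i) /\ In (t i) (transitions J) /\ In (s (S i)) (fire m J (s i) (t i)).
Proof.
  intros H0 H.
  destruct (dependent_choice Q (fun s s' => exists t, In t (transitions J) /\ In s' (fire m J s t))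
    s0 H0) as (s & E & Hs).
  { intros s Hs. destruct (H s Hs) as (t & s' & ? & ? & ?). eauto. }
  assert (Ht : forall i, {t | In t (transitions J) /\ In (s (S i)) (fire m J (s i) t)}).
  { intros i. apply constructive_indefinite_description. apply Hs. }
  exists s, (fun i => proj1_sig (Ht i)). split; auto. intros i. split; [apply Hs|].
  apply (proj2_sig (Ht i)).
Qed.

Lemma run_segment (s : nat -> state) (t : nat -> ttrans) i k :
  (forall i, In (t i) (transitions J) /\ In (s (S i)) (fire m J (s i) (t i))) ->
  trun (s i) (map t (seq i k)) (s (i + k)).
Proof.
  intros H. revert i. induction k as [|k IH]; intros i; simpl.
  - rewrite Nat.add_0_r. constructor.
  - destruct (H i). rewrite Nat.add_succ_r. econstructor; eauto.
Qed.

(** The invariant is that some pumped state can still be reached. On arrival there, one more round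
    of the nonempty loop renews it. Pumped states are live, and so are all states from which they
    are reached. *)
Lemma pump_cert_nonterminating C : pump_cert m J C = true -> ~ OB_terminating I.
Proof.
  intros H Hterm. apply Hterm. clear Hterm.
  apply pump_cert_loop in H
    as (ts0 & ts & st & st' & z & R0 & R & Hne & Hc & He & Hw & Hz & L).
  pose proof (trun_shape I m WF _ _ _ (shape_start I WF) R0) as S0.
  assert (Hts : ts <> []).
  { intros ->. inversion R; subst. now apply Hne. }
  destruct (infinite_run (fun s => exists ts' k, trun s ts' (pumped st ts z k)) (start J))
    as (s & t & E0 & Hst).
  { exists ts0, 0. erewrite pumped_0; eauto. }
  { intros s (ts' & k & Rk).
    assert (Rk' : exists t ts'' k', trun s (t :: ts'') (pumped st ts z k')).
    { destruct ts' as [|t ts'']; [|eauto].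
      inversion Rk; subst. destruct ts as [|t ts''] eqn:Ets; [easy|]. rewrite <- Ets in *.
      exists t, ts'', (S k). rewrite <- Ets. eapply pumping; eauto. }
    destruct Rk' as (t & ts'' & k' & R'). inversion R' as [|? ? s1 ? ? Ht Hf Hr]; subst.
    exists t, s1. eauto. }
  assert (Rs : forall i, trun (start J) (map t (seq 0 i)) (s i)).
  { intros i. rewrite <- E0. apply (run_segment s t 0 i). intros j. apply Hst. }
  exists (fun i => cfg (s i)), (fun i => act_of (t i)). split.
  - rewrite E0. apply cfg_start, WF.
  - intros i. split.
    + apply (fire_fifo_step I m WF); try apply Hst.
      eapply trun_shape; [apply WF|apply shape_start, WF|apply Rs].
    + rewrite <- map_map. eapply (live_pref I m WF); [apply Rs|].
      destruct (proj1 (Hst (S i))) as (ts' & k & Rk).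
      eapply trun_live; [apply WF| |apply Rk|now apply live_pumped].
      eapply trun_shape; [apply WF|apply shape_start, WF|apply Rs].
Qed.

(** Membership in [F] spreads from the final state of an accepting path back to its first state. *)
Lemma alive_of_live F st : closed_back J F = true -> live I st -> alive J F st = true.
Proof.
  intros HF [us Hu]. unfold alive, closed_back in *. rewrite forallb_forall in *.
  intros c Hc. specialize (HF c Hc). unfold channels in Hc.
  rewrite (length_langs I WF) in Hc. apply in_seq in Hc.
  specialize (Hu c ltac:(lia)). rewrite lang_conv in *.
  apply andb_prop in HF as [HF1 HF2]. rewrite forallb_forall in HF1, HF2.
  apply accepts_spec in Hu as (p & q & Hp & Hq & Hpath).
  apply existsb_exists. exists p. split; auto.
  assert (Hin : mem q (nth c F []) = true) by now apply HF1.
  clear Hp Hq. induction Hpath as [|p a q u r Ht _ IH]; auto.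
  apply in_edges in Ht. specialize (HF2 _ Ht). simpl in HF2. now rewrite IH in HF2.
Qed.

Lemma mem_state_spec st S : mem_state st S = true <-> In st S.
Proof.
  unfold mem_state. rewrite existsb_exists. split.
  - intros (s & Hs & E). apply (eqe_spec _ _ injective_state) in E. now subst.
  - intros H. exists st. split; auto. now apply (eqe_spec _ _ injective_state).
Qed.

(** Every state on the way to a live state is live, hence passes the [alive] test, so the run never
    leaves [S]. *)
Lemma finite_cert_sound S F st ts :
  finite_cert m J (S, F) = true -> trun (start J) ts st -> live I st -> In st S.
Proof.
  unfold finite_cert. cbn [fst snd]. intros H.
  apply andb_prop in H as [H H3]. apply andb_prop in H as [H1 H2].
  apply mem_state_spec in H1. rewrite forallb_forall in H3.
  pose proof (shape_start I WF) as Hs.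
  generalize (start J) H1 Hs. clear H1 Hs. intros s Hin Hs R L.
  induction R as [s|s t s1 ts s2 Ht Hf R IH]; auto.
  pose proof (fire_shape I m WF _ _ _ Hs Ht Hf) as Hs1.
  apply IH; auto. specialize (H3 _ Hin). rewrite forallb_forall in H3.
  specialize (H3 s1). rewrite in_flat_map in H3.
  rewrite (alive_of_live F s1 H2) in H3 by (eapply trun_live; eauto).
  apply mem_state_spec. apply H3. eauto.
Qed.

Lemma finite_cert_bounded C : finite_cert m J C = true -> ~ OB_unbounded I.
Proof.
  destruct C as [S F]. intros H Hub. apply Hub. exists (map cfg S).
  intros s (sigma & HP & HR). rewrite <- (cfg_start I WF) in HR.
  destruct (fifo_reach_trun I m WF _ _ _ HR (start J) (shape_start I WF) eq_refl)
    as (ts & st & R & <- & <-).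
  apply in_map. eapply finite_cert_sound; eauto. eapply pref_live; eauto.
Qed.

(** When the clock ticks, it shows the number of steps made, and a finite set of states holds only
    finitely many clock values. *)
Lemma finite_cert_terminating C : m = 1 -> finite_cert m J C = true -> OB_terminating I.
Proof.
  destruct C as [S F]. intros Hm H (s & beta & E0 & Hstep).
  assert (HR : forall k i, fifo_reach M (s i) (map beta (seq i k)) (s (i + k))).
  { induction k as [|k IH]; intros i; simpl.
    - rewrite Nat.add_0_r. constructor.
    - rewrite Nat.add_succ_r. econstructor; [apply Hstep|]. apply (IH (1 + i)). }
  (* The language condition at index [i] concerns the first [1 + i] actions, hence the shift. *)
  assert (HS : forall i, exists st, In st S /\ clock st = 1 + i).
  { intros i. pose proof (HR (1 + i) 0) as HRi. rewrite E0, <- (cfg_start I WF) in HRi.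
    destruct (fifo_reach_trun I m WF _ _ _ HRi (start J) (shape_start I WF) eq_refl)
      as (ts & st & R & _ & Ets).
    exists st. split.
    - eapply finite_cert_sound; eauto. eapply pref_live; eauto. rewrite Ets. apply Hstep.
    - rewrite (trun_clock I m WF _ _ _ (shape_start I WF) R).
      rewrite <- (length_map act_of), Ets, length_map, length_seq, Hm.
      unfold start, clock. cbn [fst]. lia. }
  apply (not_in_list_of_unbounded (fun i => 1 + i) (map clock S)); [lia|].
  intros i. destruct (HS i) as (st & Hin & <-). now apply in_map.
Qed.

End Soundness.

(** * Subsequences *)

Definition increasing (f : nat -> nat) : Prop := forall i, f i < f (S i).

Lemma increasing_lt f i j : increasing f -> i < j -> f i < f j.
Proof.
  intros Hf H. induction H as [|j _ IH]; [apply Hf|]. specialize (Hf j). lia.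
Qed.

Lemma increasing_comp f g : increasing f -> increasing g -> increasing (fun i => f (g i)).
Proof. intros Hf Hg i. apply increasing_lt; auto. Qed.

Lemma infinitely_often (P : nat -> Prop) :
  (forall i, exists j, i <= j /\ P j) -> exists g, increasing g /\ forall i, P (g i).
Proof.
  intros H. destruct (H 0) as (j0 & _ & H0).
  destruct (dependent_choice P lt j0 H0) as (g & _ & Hg).
  - intros x _. destruct (H (S x)) as (y & Hy & Py). exists y. split; auto.
  - exists g. split; intros i; apply Hg.
Qed.

(* Every infinite set of indices contains an infinite set on which [R] holds pairwise. *)
Definition ramsey (R : nat -> nat -> Prop) : Prop :=
  forall f, increasing f ->
  exists g, increasing g /\ forall i j, i < j -> R (f (g i)) (f (g j)).

(** The reason why [ramsey] quantifies over all [f]: the second relation is made homogeneous inside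
    the subsequence found for the first. *)
Lemma ramsey_and R1 R2 : ramsey R1 -> ramsey R2 -> ramsey (fun i j => R1 i j /\ R2 i j).
Proof.
  intros H1 H2 f Hf. destruct (H1 f Hf) as (g & Hg & G).
  destruct (H2 (fun i => f (g i))) as (h & Hh & K); [now apply increasing_comp|].
  exists (fun i => g (h i)). split; [now apply increasing_comp|].
  intros i j Hij. split; auto. apply G. now apply increasing_lt.
Qed.

Lemma ramsey_impl (R1 R2 : nat -> nat -> Prop) :
  (forall i j, i < j -> R1 i j -> R2 i j) -> ramsey R1 -> ramsey R2.
Proof.
  intros H H1 f Hf. destruct (H1 f Hf) as (g & Hg & G). exists g. split; auto.
  intros i j Hij. apply H; auto. apply (increasing_lt (fun i => f (g i))); auto.
  now apply increasing_comp.
Qed.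

Lemma ramsey_all (R : nat -> nat -> nat -> Prop) k :
  (forall c, c < k -> ramsey (R c)) -> ramsey (fun i j => forall c, c < k -> R c i j).
Proof.
  induction k as [|k IH]; intros H.
  - intros f Hf. exists (fun i => i). split; [intros i; lia|]. intros i j _ c Hc. lia.
  - apply ramsey_impl with (R1 := fun i j => (forall c, c < k -> R c i j) /\ R k i j).
    + intros i j _ [H1 H2] c Hc. destruct (Nat.eq_dec c k) as [->|]; auto. apply H1. lia.
    + apply ramsey_and; auto.
Qed.

Lemma ramsey_ge k : ramsey (fun i _ => k <= i).
Proof.
  intros f Hf. exists (fun i => k + i). split; [intros i; lia|]. intros i j _.
  enough (forall x, x <= f x) by (specialize (H (k + i)); lia).
  induction x as [|x IH]; [lia|]. specialize (Hf x). lia.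
Qed.

(** Values cannot decrease forever, so beyond every index there is one whose value is minimal among
    all later ones; these indices form the subsequence. Combined with [ramsey_and] and [ramsey_all]
    this is Dickson's lemma. *)
Lemma ramsey_le (h : nat -> nat) : ramsey (fun i j => h i <= h j).
Proof.
  intros f Hf.
  destruct (infinitely_often (fun i => forall j, i <= j -> h (f i) <= h (f j))) as (g & Hg & G).
  - intros i. enough (E : forall v i', i <= i' -> h (f i') <= v ->
      exists j, i <= j /\ forall k, j <= k -> h (f j) <= h (f k)) by (eapply E; eauto).
    induction v as [|v IH]; intros i' Hi Hv.
    + exists i'. split; auto. intros k _. lia.
    + destruct (classic (exists k, i' <= k /\ h (f k) <= v)) as [(k & Hk & Hkv)|No].
      * apply (IH k); auto. lia.
      * exists i'. split; auto. intros k Hk.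
        destruct (Nat.le_gt_cases (h (f i')) (h (f k))); auto.
        exfalso. apply No. exists k. split; auto. lia.
  - exists g. split; auto. intros i j Hij. apply G.
    apply Nat.lt_le_incl, increasing_lt; auto.
Qed.

(** The infinite pigeonhole principle: the first colour either recurs forever or is absent from some
    index on, where one colour fewer remains. *)
Lemma ramsey_color {A} (h : nat -> A) (l : list A) :
  (forall i, In (h i) l) -> ramsey (fun i j => h i = h j).
Proof.
  intros H f Hf.
  assert (Hl : forall i, In (h (f i)) l) by auto. clear H.
  enough (E : exists g, increasing g /\ forall i j, h (f (g i)) = h (f (g j))).
  { destruct E as (g & ? & ?). exists g. auto. }
  revert f Hf Hl. induction l as [|a l IH]; intros f Hf Hl; [destruct (Hl 0)|].
  destruct (classic (forall i, exists j, i <= j /\ h (f j) = a)) as [Inf|Fin].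
  - destruct (infinitely_often _ Inf) as (g & Hg & G). exists g. split; auto.
    intros i j. now rewrite !G.
  - apply not_all_ex_not in Fin as [k Hk].
    destruct (IH (fun i => f (k + i))) as (g & Hg & G).
    + intros i. rewrite Nat.add_succ_r. apply Hf.
    + intros i. destruct (Hl (k + i)) as [E|]; auto. exfalso. apply Hk.
      exists (k + i). split; [lia|auto].
    + exists (fun i => k + g i). split; auto. intros i. specialize (Hg i). lia.
Qed.

Fixpoint sublists {A} (l : list A) : list (list A) :=
  match l with
  | [] => [[]]
  | a :: l => sublists l ++ map (cons a) (sublists l)
  end.

Lemma filter_sublists {A} (p : A -> bool) l : In (filter p l) (sublists l).
Proof.
  induction l as [|a l IH]; simpl; auto. apply in_app_iff.
  destruct (p a); auto. right. now apply in_map.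
Qed.

Lemma finite_choice {A} (R : nat -> A -> Prop) d k :
  (forall c, c < k -> exists x, R c x) -> exists l, forall c, c < k -> R c (nth c l d).
Proof.
  intros H. enough (E : exists l, length l = k /\ forall c, c < k -> R c (nth c l d))
    by (destruct E as (l & _ & ?); eauto).
  induction k as [|k IH].
  - exists []. split; auto. intros c Hc. lia.
  - destruct IH as (l & Hl & E); auto. destruct (H k) as [x Hx]; auto.
    exists (l ++ [x]). split; [rewrite length_app; simpl; lia|]. intros c Hc.
    destruct (Nat.eq_dec c k) as [->|].
    + subst k. now rewrite nth_middle.
    + rewrite app_nth1 by lia. apply E. lia.
Qed.

(** The predicate need not be decidable, as the list is only claimed to exist. *)
Lemma classical_filter {A} (P : A -> Prop) l : exists l', forall x, In x l' <-> In x l /\ P x.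
Proof.
  induction l as [|a l (l' & IH)]; [exists []; firstorder|].
  destruct (classic (P a)) as [Ha|Ha].
  - exists (a :: l'). intros x. simpl. rewrite IH. split.
    + intros [->|[]]; auto.
    + intros [[->|] ]; auto.
  - exists l'. intros x. simpl. rewrite IH. split; [tauto|].
    intros [[->|] ]; tauto.
Qed.

(** * Words of a bounded language *)

Definition factor (r : nat -> nat) (i k : nat) : word := map r (seq i k).

Lemma factor_app r i k l : factor r i (k + l) = factor r i k ++ factor r (i + k) l.
Proof. unfold factor. now rewrite seq_app, map_app. Qed.

Lemma factor_length r i k : length (factor r i k) = k.
Proof. unfold factor. now rewrite length_map, length_seq. Qed.

Lemma nth_factor r i k j d : j < k -> nth j (factor r i k) d = r (i + j).
Proof.
  intros H. unfold factor. rewrite nth_indep with (d' := r 0)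
    by now rewrite length_map, length_seq.
  now rewrite map_nth, seq_nth.
Qed.

Lemma app_prefix {A} (u v x y : list A) :
  u ++ x = v ++ y -> length u <= length v -> exists w, v = u ++ w /\ x = w ++ y.
Proof.
  intros E L. exists (skipn (length u) v).
  assert (F : firstn (length u) v = u).
  { apply (f_equal (firstn (length u))) in E.
    rewrite !firstn_app, Nat.sub_diag, firstn_O, firstn_all in E.
    replace (length u - length v) with 0 in E by lia.
    rewrite firstn_O, !app_nil_r in E. auto. }
  split.
  - pose proof (firstn_skipn (length u) v) as G. rewrite F in G. now symmetry.
  - rewrite <- (firstn_skipn (length u) v), F, <- app_assoc in E.
    now apply app_inv_head in E.
Qed.

Lemma app_eq_length {A} (u v x y : list A) :
  u ++ x = v ++ y -> length u = length v -> u = v.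
Proof.
  intros E L. apply app_prefix in E as (w & E & _); [|lia].
  rewrite E, length_app in L. destruct w; [|simpl in L; lia]. now rewrite E, app_nil_r.
Qed.

Lemma pow_S w k : pow w (S k) = w ++ pow w k.
Proof. reflexivity. Qed.

Lemma pow_S_r w k : pow w (S k) = pow w k ++ w.
Proof. rewrite pow_S. symmetry. now apply pow_comm. Qed.

(** If each of the [k] candidates failed at some index, monotonicity would make all of them fail at
    the sum of these indices. *)
Lemma uniform_bound (B : nat -> nat -> Prop) k :
  (forall c i j, i <= j -> B c j -> B c i) ->
  (forall i, exists c, c < k /\ B c i) -> exists c, c < k /\ forall i, B c i.
Proof.
  intros Mono H. apply NNPP. intros No.
  assert (E : forall k', k' <= k -> exists i, forall c, c < k' -> ~ B c i).
  { induction k' as [|k' IH]; intros Hk; [exists 0; lia|].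
    destruct IH as [i Hi]; [lia|].
    assert (X : exists j, ~ B k' j).
    { apply not_all_ex_not. intros X. apply No. exists k'. split; auto. }
    destruct X as [j Hj]. exists (i + j). intros c Hc HB.
    destruct (Nat.eq_dec c k') as [->|].
    - apply Hj. apply (Mono _ _ (i + j)); auto. lia.
    - apply (Hi c); [lia|]. apply (Mono _ _ (i + j)); auto. lia. }
  destruct (E k (le_n k)) as [i Hi]. destruct (H i) as (c & Hc & HB). exact (Hi c Hc HB).
Qed.

Definition ultimately_periodic (r : nat -> nat) : Prop :=
  exists N p, 0 < p /\ forall k, N <= k -> r (k + p) = r k.

(** Either all prefixes of the stream are prefixes of powers of [w], and the stream has period
    [length w]; or some prefix is not, which bounds the number of leading copies of [w]. Then one
    number of copies works for arbitrarily long prefixes, and the rest of the stream is governed by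
    the remaining words. *)
Lemma bounded_ultimately_periodic ws r :
  Forall (fun w => w <> []) ws ->
  (forall k, exists v, in_bounded ws (factor r 0 k ++ v)) -> ultimately_periodic r.
Proof.
  intros Hws. revert r. induction Hws as [|w ws Hw _ IH]; intros r H.
  { destruct (H 1) as [v Hv]. discriminate. }
  assert (Hlw : 0 < length w) by (destruct w; [easy|simpl; lia]).
  destruct (classic (forall k, exists l v, factor r 0 k ++ v = pow w l)) as [P|P].
  - exists 0, (length w). split; auto. intros k _.
    (* The shortest prefix containing both positions to be compared, [k] and [k + length w]. *)
    destruct (P (k + length w + 1)) as (l & v & E).
    assert (L : k + length w + 1 <= l * length w).
    { rewrite <- pow_length, <- E, length_app, factor_length. lia. }
    destruct l as [|l]; [lia|].
    assert (N : forall j, j < k + length w + 1 -> nth j (pow w (S l)) 0 = r j).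
    { intros j Hj. rewrite <- E, app_nth1 by now rewrite factor_length.
      now rewrite nth_factor. }
    rewrite <- (N (k + length w)), <- (N k) by lia.
    assert (Hk : k < length (pow w l)) by (rewrite pow_length; simpl in L; lia).
    (* Splitting off a copy of [w] in front for the later position, and at the end for the earlier
       one, leads to the same place in [pow w l]. *)
    rewrite pow_S_r at 2. rewrite pow_S, (app_nth1 (pow w l) w) by auto.
    rewrite app_nth2 by lia. f_equal. lia.
  - apply not_all_ex_not in P as [n0 P].
    destruct (uniform_bound
      (fun l k => exists v, in_bounded ws (factor r (l * length w) k ++ v)) n0)
      as (l & _ & Hl).
    + intros c i j Hij [v Hv]. exists (factor r (c * length w + i) (j - i) ++ v).
      rewrite app_assoc, <- factor_app. now replace (i + (j - i)) with j by lia.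
    + intros k. destruct (H (n0 + k)) as (v & l & v2 & E & Hv2).
      change (concat (repeat w l)) with (pow w l) in E.
      assert (L : l * length w < n0).
      { destruct (Nat.le_gt_cases n0 (l * length w)) as [L|]; auto. exfalso. apply P.
        rewrite factor_app, <- app_assoc in E.
        apply app_prefix in E as (x & E & _); [|now rewrite factor_length, pow_length].
        exists l, x. now symmetry. }
      exists l. split; [nia|].
      symmetry in E. apply app_prefix in E as (x & E & E');
        [|rewrite factor_length, pow_length; lia].
      assert (Ex : x = factor r (l * length w) (n0 + k - l * length w)).
      { replace (n0 + k) with (l * length w + (n0 + k - l * length w)) in E by lia.
        rewrite factor_app in E. simpl in E.
        apply app_inv_head with (l := pow w l). rewrite <- E. f_equal.
        apply app_eq_length in E; auto. now rewrite factor_length, pow_length. }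
      exists (factor r (l * length w + k) (n0 - l * length w) ++ v).
      rewrite app_assoc, <- factor_app.
      replace (k + (n0 - l * length w)) with (n0 + k - l * length w) by lia.
      now rewrite <- Ex, <- E'.
    + destruct (IH (fun k => r (l * length w + k))) as (N & p & Hp & Hper).
      * intros k. destruct (Hl k) as [v Hv]. exists v.
        replace (factor (fun k => r (l * length w + k)) 0 k) with (factor r (l * length w) k); auto.
        apply nth_ext with (d := 0) (d' := 0); rewrite !factor_length; auto.
        intros i Hi. now rewrite !nth_factor.
      * exists (l * length w + N), p. split; auto. intros k Hk.
        specialize (Hper (k - l * length w) ltac:(lia)).
        replace (l * length w + (k - l * length w + p)) with (k + p) in Hper by lia.
        replace (l * length w + (k - l * length w)) with k in Hper by lia. exact Hper.
Qed.

Lemma periodic_mult (r : nat -> nat) N p a k :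
  (forall k, N <= k -> r (k + p) = r k) -> N <= k -> r (k + p * a) = r k.
Proof.
  intros H Hk. induction a as [|a IH]; [now rewrite Nat.mul_0_r, Nat.add_0_r|].
  rewrite <- IH. rewrite <- (H (k + p * a)) by lia. f_equal. lia.
Qed.

Lemma factor_shift r N p a i k :
  (forall k, N <= k -> r (k + p) = r k) -> N <= i -> factor r (i + p * a) k = factor r i k.
Proof.
  intros H Hi. apply nth_ext with (d := 0) (d' := 0); rewrite !factor_length; auto.
  intros j Hj. rewrite !nth_factor by auto.
  rewrite <- (periodic_mult r N p a (i + j)) by (auto; lia). f_equal. lia.
Qed.

(** * Completeness of the certificates *)

Section Completeness.
Context (I : instance) (m : nat) (WF : wf_instance I).
Notation J := (conv I).
Notation M := (i_fifo I).
Notation n := (f_nchan M).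
Notation shape := (shape I).
Notation trun := (trun I m).

Lemma coreachable_sets :
  exists F, closed_back J F = true /\
    forall st, alive J F st = true -> live I st.
Proof.
  set (co := fun c p => exists u q, nfa_path (nth c (i_langs I) dnfa) p u q /\
                                   In q (n_final (nth c (i_langs I) dnfa))).
  (* An accepting path is empty or begins with an edge, so the final states and the sources of edges
     include all coreachable states. *)
  destruct (finite_choice (fun c G => forall p, In p G <->
     In p (n_final (nth c (i_langs I) dnfa) ++
           map (fun t => fst (fst t)) (n_trans (nth c (i_langs I) dnfa))) /\ co c p) [] n)
    as [F HF].
  { intros c _. apply classical_filter. }
  exists F. split.
  - unfold closed_back, channels. rewrite forallb_forall, (length_langs I WF).
    intros c Hc. apply in_seq in Hc. specialize (HF c ltac:(lia)).
    rewrite lang_conv. apply andb_true_intro. rewrite !forallb_forall. split.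
    + intros p Hp. apply mem_spec, HF. split; [now apply in_or_app; left|].
      exists [], p. split; auto. constructor.
    + intros [p [a q]] Ht. apply in_edges in Ht. simpl.
      destruct (mem q (nth c F [])) eqn:E; auto. simpl.
      apply mem_spec, HF in E as [_ (u & r & Hu & Hr)].
      apply mem_spec, HF. split.
      * apply in_or_app. right. apply in_map_iff. now exists (p, a, q).
      * exists (a :: u), r. split; auto. econstructor; eauto.
  - intros st H. unfold live.
    apply (finite_choice (fun c u => accepts (lang J c) (nth c (sets st) []) u = true)).
    intros c Hc.
    unfold alive, channels in H. rewrite forallb_forall, (length_langs I WF) in H.
    specialize (H c). rewrite in_seq in H. specialize (H ltac:(lia)).
    apply existsb_exists in H as (p & Hp & Hm). apply mem_spec, (HF c Hc) in Hm.
    destruct Hm as [_ (u & q & Hu & Hq)]. exists u. rewrite lang_conv.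
    apply accepts_spec. eauto.
Qed.

(** * Infinite runs without repetition *)

Section Escape.
Context (F : list (list nat)).

Definition closed_upto (V S : list state) : Prop :=
  forall s t s', In s S -> In t (transitions J) -> In s' (fire m J s t) ->
    alive J F s' = true -> In s' S \/ In s' V.

(* From [st], infinitely many states are reachable without passing through [V]. *)
Definition escapes (V : list state) (st : state) : Prop :=
  ~ exists S, In st S /\ closed_upto V S.

(** König's argument: if no new alive successor escaped, [st] together with the union of finite
    closed sets for these finitely many successors would be closed up to [V]. Adding [st] to the
    avoided states prevents a return to it. *)
Lemma escapes_next V st :
  escapes V st ->
  exists t st', In t (transitions J) /\ In st' (fire m J st t) /\ alive J F st' = true /\
    ~ In st' (st :: V) /\ escapes (st :: V) st'.
Proof.
  intros Hesc. apply NNPP. intros No. apply Hesc.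
  assert (U : forall L, (forall s', In s' L -> exists t, In t (transitions J) /\ In s' (fire m J st t)) ->
    exists S, closed_upto (st :: V) S /\
      forall s', In s' L -> alive J F s' = true -> In s' S \/ In s' (st :: V)).
  { induction L as [|s' L IH]; intros HL.
    - exists []. split; [intros ? ? ? []|intros ? []].
    - destruct IH as (S & HS & HSL); [intros; apply HL; now right|].
      destruct (HL s') as (t & Ht & Hf); [now left|].
      destruct (classic (alive J F s' = true /\ ~ In s' (st :: V))) as [[Ha Hn]|Hn].
      + assert (X : exists S', In s' S' /\ closed_upto (st :: V) S').
        { apply NNPP. intros X. apply No. exists t, s'. auto. }
        destruct X as (S' & Hs' & HS'). exists (S' ++ S). split.
        * intros x t' y Hx Ht' Hy Hal. rewrite in_app_iff.
          apply in_app_or in Hx as [Hx|Hx];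
            [destruct (HS' x t' y)|destruct (HS x t' y)]; auto.
        * intros y [<-|Hy] Hal; rewrite in_app_iff; auto.
          destruct (HSL y Hy Hal); auto.
      + exists S. split; auto. intros y [<-|Hy] Hal; auto.
        right. apply NNPP. auto. }
  destruct (U (flat_map (fire m J st) (transitions J))) as (S & HS & HSL).
  { intros s' Hs'. apply in_flat_map in Hs'. exact Hs'. }
  exists (st :: S). split; [now left|]. intros x t y [<-|Hx] Ht Hy Hal.
  - assert (Hin : In y (flat_map (fire m J st) (transitions J))) by (apply in_flat_map; eauto).
    destruct (HSL y Hin Hal) as [H|[->|H]]; simpl; auto.
  - destruct (HS x t y Hx Ht Hy Hal) as [H|[->|H]]; simpl; auto.
Qed.

Lemma escaping_run st :
  escapes [] st ->
  exists (s : nat -> state) (t : nat -> ttrans), s 0 = st /\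
    (forall i, In (t i) (transitions J) /\ In (s (S i)) (fire m J (s i) (t i))) /\
    (forall i, alive J F (s (S i)) = true) /\
    (forall i j, i < j -> s i <> s j).
Proof.
  intros H0.
  (* The visited states accompany the current one, so that the next state can be chosen outside
     them. *)
  destruct (dependent_choice
    (fun x : list state * state => escapes (fst x) (snd x))
    (fun x y => fst y = snd x :: fst x /\ (exists t, In t (transitions J) /\
       In (snd y) (fire m J (snd x) t)) /\ alive J F (snd y) = true /\ ~ In (snd y) (fst y))
    ([], st) H0) as (f & E0 & Hf).
  { intros [V s] Hs. destruct (escapes_next V s Hs) as (t & s' & Ht & Hs' & Ha & Hn & He).
    exists (s :: V, s'). repeat split; auto. exists t. auto. }
  assert (Ht : forall i, {t | In t (transitions J) /\
                              In (snd (f (S i))) (fire m J (snd (f i)) t)}).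
  { intros i. apply constructive_indefinite_description. apply Hf. }
  exists (fun i => snd (f i)), (fun i => proj1_sig (Ht i)). rewrite E0. split; auto.
  split; [intros i; apply (proj2_sig (Ht i))|]. split; [intros i; apply Hf|].
  assert (V : forall i j, i < j -> In (snd (f i)) (fst (f j))).
  { intros i j H. induction H as [|j _ IH].
    - destruct (Hf i) as (_ & -> & _). now left.
    - destruct (Hf j) as (_ & -> & _). now right. }
  intros i j Hij E. destruct j as [|j]; [lia|].
  destruct (Hf j) as (_ & _ & _ & _ & Hn). apply Hn. rewrite <- E. auto.
Qed.

Lemma no_cert_escapes :
  closed_back J F = true -> (forall S, finite_cert m J (S, F) = false) -> escapes [] (start J).
Proof.
  intros HF No (S & H1 & H2). specialize (No S).
  enough (E : finite_cert m J (S, F) = true) by congruence.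
  unfold finite_cert. cbn [fst snd].
  rewrite HF, (proj2 (mem_state_spec _ _) H1). simpl.
  apply forallb_forall. intros s Hs. apply forallb_forall. intros s' Hs'.
  apply in_flat_map in Hs' as (t & Ht & Hs').
  destruct (alive J F s') eqn:E; auto. simpl. apply mem_state_spec.
  destruct (H2 s t s' Hs Ht Hs' E) as [|[]]; auto.
Qed.
End Escape.

(** * Pumpable loops in an infinite run *)

Section Run.
Context (s : nat -> state) (t : nat -> ttrans) (H0 : s 0 = start J)
  (Hst : forall i, In (t i) (transitions J) /\ In (s (S i)) (fire m J (s i) (t i)))
  (Hlive : forall i, live I (s i)).

Lemma run_shape i : shape (s i).
Proof.
  induction i as [|i IH]; [rewrite H0; apply (shape_start I WF)|].
  destruct (Hst i). eapply fire_shape; eauto.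
Qed.

Definition acts (i j : nat) : list action := map act_of (map t (seq i (j - i))).

Lemma run_between i j : i <= j -> trun (s i) (map t (seq i (j - i))) (s j).
Proof.
  intros H. replace j with (i + (j - i)) at 2 by lia. now apply run_segment.
Qed.

Lemma acts_split i j k : i <= j -> j <= k -> acts i k = acts i j ++ acts j k.
Proof.
  intros H1 H2. unfold acts. rewrite <- !map_app. do 2 f_equal.
  replace (k - i) with ((j - i) + (k - j)) by lia. rewrite seq_app. do 2 f_equal. lia.
Qed.

Section Channel.
Context (c : nat) (Hc : c < n).

Definition received (i : nat) : word := proj_recv c (acts 0 i).
Definition sends (i : nat) : word := proj_send c (acts 0 i).
Definition content (i : nat) : word := nth c (chans (s i)) [].

Lemma received_content i : received i ++ content i = sends i.
Proof.
  pose proof (trun_chans I m WF _ _ _ c (run_shape 0) (run_between 0 i (Nat.le_0_l i))) as E.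
  rewrite H0, chans_start in E. exact E.
Qed.

Lemma received_split i j : i <= j -> received j = received i ++ proj_recv c (acts i j).
Proof.
  intros H. unfold received. rewrite (acts_split 0 i j) by lia. apply proj_recv_app.
Qed.

Lemma sends_split i j : i <= j -> sends j = sends i ++ proj_send c (acts i j).
Proof.
  intros H. unfold sends. rewrite (acts_split 0 i j) by lia. apply proj_send_app.
Qed.

Lemma received_language i : exists u, lang_of I c (received i ++ u).
Proof.
  destruct (Hlive i) as [us Hu]. exists (nth c us []). apply accepts_lang_of.
  rewrite accepts_app, <- sets_start.
  change (received i) with (proj_recv c (acts 0 i)). unfold acts.
  rewrite <- H0, <- (trun_sets I m WF _ _ _ c (run_shape 0) (run_between 0 i (Nat.le_0_l i))).
  auto.
Qed.

(** An updated set is, as a list, the image of a sublist of the edges, which leaves finitely many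
    values. Equality of lists is also what [pump_cert] tests. *)
Lemma sets_ramsey : ramsey (fun i j => nth c (sets (s i)) [] = nth c (sets (s j)) []).
Proof.
  apply ramsey_color with (l := nth c (sets (s 0)) [] ::
    map (map (fun e => snd (snd e))) (sublists (edges (lang J c)))).
  induction i as [|i IH]; [now left|].
  destruct (Hst i) as [Ht Hf].
  rewrite (fire_sets I m WF _ _ _ c (run_shape i) Ht Hf).
  destruct (act_of (t i)) as [c' a|c' a]; simpl recd; [exact IH|].
  destruct (c' =? c); [|exact IH]. right. simpl. unfold delta at 1.
  apply in_map, filter_sublists.
Qed.

Definition pumpable (i j : nat) : Prop :=
  exists z, content j = content i ++ z /\
    z ++ proj_send c (acts i j) = proj_send c (acts i j) ++ z.

(** Nothing is received in between, so the content grows by exactly the word sent, which commutes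
    with itself. *)
Lemma pumpable_without_receives i j :
  i <= j -> length (received i) = length (received j) -> pumpable i j.
Proof.
  intros H E. exists (proj_send c (acts i j)). split; auto.
  pose proof (received_split i j H) as R.
  assert (R' : proj_recv c (acts i j) = []).
  { apply length_zero_iff_nil. rewrite R, length_app in E. lia. }
  pose proof (trun_chans I m WF _ _ _ c (run_shape i) (run_between i j H)) as C.
  change (map act_of (map t (seq i (j - i)))) with (acts i j) in C.
  now rewrite R' in C.
Qed.

(* With infinitely many receives, all that is sent is received, so that the received
   stream determines the sent one and the channel contents. *)
Lemma received_stream :
  (forall k, exists i, k <= length (received i)) ->
  exists r, (forall i, received i = factor r 0 (length (received i))) /\
            (forall i, sends i = factor r 0 (length (sends i))).
Proof.
  intros Inf.
  assert (f : forall k, {i | S k <= length (received i)}).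
  { intros k. apply constructive_indefinite_description. apply Inf. }
  set (r := fun k => nth k (received (proj1_sig (f k))) 0).
  assert (E : forall i k, k < length (received i) -> nth k (received i) 0 = r k).
  { intros i k Hk. unfold r. destruct (f k) as [j Hj]. simpl.
    destruct (Nat.le_ge_cases i j) as [H|H].
    - rewrite (received_split i j H). now rewrite app_nth1.
    - rewrite (received_split j i H). rewrite app_nth1; auto. }
  assert (R : forall i, received i = factor r 0 (length (received i))).
  { intros i. apply nth_ext with (d := 0) (d' := 0); [now rewrite factor_length|].
    intros k Hk. rewrite nth_factor by auto. now apply E. }
  exists r. split; auto. intros i.
  (* At a time [j] after [i] when that many letters have been received, [sends i] is a prefix of
     [received j] and thus of the stream. *)
  destruct (Inf (length (sends i))) as [j0 Hj0].
  set (j := i + j0).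
  assert (Hj : length (sends i) <= length (received j)).
  { rewrite (received_split j0 j), length_app by (unfold j; lia). lia. }
  pose proof (received_content j) as C. rewrite (sends_split i j) in C by (unfold j; lia).
  symmetry in C. apply app_prefix in C as (w & C & _); auto.
  rewrite R in C.
  replace (length (received j))
    with (length (sends i) + (length (received j) - length (sends i))) in C by lia.
  rewrite factor_app in C. symmetry in C.
  apply app_eq_length in C; auto. now rewrite factor_length.
Qed.

(** The received length grows by [p * a] and the sent length by [p * b], hence the content by
    [p * (b - a)]. The word appended and the word sent are factors of the periodic part that begin
    at the same position and have lengths divisible by [p], so they commute. *)
Lemma pumpable_with_receives r N p i j :
  (forall i, received i = factor r 0 (length (received i))) ->
  (forall i, sends i = factor r 0 (length (sends i))) ->
  (forall k, N <= k -> r (k + p) = r k) -> 0 < p -> i <= j ->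
  N <= length (received i) ->
  length (received i) mod p = length (received j) mod p ->
  length (sends i) mod p = length (sends j) mod p ->
  length (content i) <= length (content j) -> pumpable i j.
Proof.
  intros R S Hper Hp Hij HN HR HS HC.
  set (ri := length (received i)) in *. set (rj := length (received j)) in *.
  set (si := length (sends i)) in *. set (sj := length (sends j)) in *.
  assert (C : forall i, content i =
    factor r (length (received i)) (length (content i)) /\
    length (sends i) = length (received i) + length (content i)).
  { intros k. pose proof (received_content k) as C.
    assert (L : length (sends k) = length (received k) + length (content k))
      by now rewrite <- C, length_app.
    split; auto. rewrite S, L, factor_app, <- R in C. now apply app_inv_head in C. }
  destruct (C i) as [Ci Li], (C j) as [Cj Lj]. fold ri si in Ci, Li. fold rj sj in Cj, Lj.
  assert (Lr : ri <= rj).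
  { unfold ri, rj. rewrite (received_split i j Hij), length_app. lia. }
  assert (Ls : si <= sj).
  { unfold si, sj. rewrite (sends_split i j Hij), length_app. lia. }
  assert (Div : forall x y, x <= y -> x mod p = y mod p -> exists a, y = x + p * a).
  { intros x y Hxy E. exists (y / p - x / p).
    pose proof (Nat.div_mod_eq x p). pose proof (Nat.div_mod_eq y p).
    pose proof (Nat.Div0.div_le_mono x y p Hxy).
    rewrite Nat.mul_sub_distr_l. nia. }
  destruct (Div ri rj Lr HR) as [a Ea], (Div si sj Ls HS) as [b Eb].
  assert (Hba : a <= b) by nia.
  assert (El : length (content j) = length (content i) + p * (b - a))
    by (rewrite Nat.mul_sub_distr_l; nia).
  assert (Es : proj_send c (acts i j) = factor r si (p * b)).
  { pose proof (sends_split i j Hij) as E. rewrite (S j) in E. fold sj in E.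
    rewrite Eb, factor_app in E. rewrite (S i) in E. fold si in E.
    now apply app_inv_head in E. }
  (* The content at time [i] ends at position [si] of the stream, where the appended word begins. *)
  exists (factor r si (p * (b - a))). split.
  - rewrite Cj, El, Ea, (factor_shift r N p a), factor_app by auto.
    now rewrite <- Ci, Li.
  - rewrite Es.
    (* Each side becomes a single factor of the stream once its second word is moved on by a
       multiple of the period. *)
    rewrite <- (factor_shift r N p (b - a) si (p * b)) at 1 by (auto; lia).
    rewrite <- factor_app.
    rewrite <- (factor_shift r N p b si (p * (b - a))) by (auto; lia).
    rewrite <- factor_app. f_equal. lia.
Qed.

(** If the receives are unbounded, the stream is ultimately periodic, and residues modulo the period
    together with the order of content lengths select the subsequence; [i0] makes it start inside
    the periodic part. Otherwise the number of receives takes finitely many values and serves as the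
    colour. *)
Lemma pumpable_ramsey : ramsey pumpable.
Proof.
  destruct (classic (forall k, exists i, k <= length (received i))) as [Inf|Fin].
  - destruct (received_stream Inf) as (r & R & Sr).
    assert (Per : ultimately_periodic r).
    { destruct WF as (_ & _ & W). destruct (W c Hc) as (_ & _ & ws & Hws & Hb).
      apply (bounded_ultimately_periodic ws).
      - eapply Forall_impl; [|exact Hws]. now intros w [Hw _].
      - intros k. destruct (Inf k) as [i Hi].
        destruct (received_language i) as [u Hu]. apply Hb in Hu.
        exists (factor r k (length (received i) - k) ++ u).
        rewrite app_assoc. rewrite <- (factor_app r 0 k).
        replace (k + (length (received i) - k)) with (length (received i)) by lia.
        now rewrite <- R. }
    destruct Per as (N & p & Hp & Hper). destruct (Inf N) as [i0 Hi0].
    apply ramsey_impl with (R1 := fun i j =>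
      i0 <= i /\
      length (received i) mod p = length (received j) mod p /\
      length (sends i) mod p = length (sends j) mod p /\
      length (content i) <= length (content j)).
    + intros i j Hij (Hi & E1 & E2 & E3).
      apply (pumpable_with_receives r N p); auto; try lia.
      rewrite (received_split i0 i), length_app by auto. lia.
    + repeat apply ramsey_and.
      * apply ramsey_ge.
      * apply ramsey_color with (l := seq 0 p). intros i. apply in_seq.
        pose proof (Nat.mod_upper_bound (length (received i)) p). lia.
      * apply ramsey_color with (l := seq 0 p). intros i. apply in_seq.
        pose proof (Nat.mod_upper_bound (length (sends i)) p). lia.
      * apply ramsey_le.
  - apply not_all_ex_not in Fin as [k Hk].
    apply ramsey_impl with (R1 := fun i j => length (received i) = length (received j)).
    + intros i j Hij. apply pumpable_without_receives. lia.
    + apply ramsey_color with (l := seq 0 k). intros i. apply in_seq.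
      destruct (Nat.le_gt_cases k (length (received i))); [exfalso; eauto|lia].
Qed.

End Channel.

Lemma ctl_ramsey : ramsey (fun i j => ctl (s i) = ctl (s j)).
Proof.
  apply ramsey_color with (l := ctl (s 0) :: map (fun t => snd (snd t)) (transitions J)).
  intros [|i]; [now left|]. right. destruct (Hst i) as [Ht Hf].
  apply fire_spec in Hf as (_ & <- & _);
    [|apply run_shape|now apply (transitions_chan I WF)].
  apply in_map_iff. eauto.
Qed.

(** Control state, automaton sets and pumpability of all channels are made homogeneous at once; the
    first two indices of the resulting subsequence delimit the loop. *)
Lemma run_pump_cert : (forall i j, i < j -> s i <> s j) -> exists C, pump_cert m J C = true.
Proof.
  intros Hinj.
  assert (Hr : ramsey (fun i j => ctl (s i) = ctl (s j) /\ forall c, c < n ->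
    nth c (sets (s i)) [] = nth c (sets (s j)) [] /\ pumpable c i j)).
  { apply ramsey_and; [apply ctl_ramsey|]. apply ramsey_all. intros c Hc.
    apply ramsey_and; [apply sets_ramsey|now apply pumpable_ramsey]. }
  destruct (Hr (fun i => i)) as (g & Hg & G); [intros i; lia|].
  destruct (G 0 1) as [Ectl HG]; [lia|]. specialize (Hg 0).
  set (i := g 0) in *. set (j := g 1) in *. clear Hr G.
  pose proof (run_shape i) as Si. pose proof (run_shape j) as Sj.
  pose proof (run_between 0 i (Nat.le_0_l i)) as R1.
  pose proof (run_between i j (Nat.lt_le_incl _ _ Hg)) as R2.
  set (ts := map t (seq i (j - i))) in *.
  assert (Esets : sets (s i) = sets (s j)).
  { destruct Si as [_ Li], Sj as [_ Lj].
    apply nth_ext with (d := []) (d' := []); [congruence|].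
    intros c Hc. apply HG. congruence. }
  destruct (finite_choice (fun c z => content c j = content c i ++ z /\
    z ++ proj_send c (acts i j) = proj_send c (acts i j) ++ z) [] n) as [zs Hzs].
  { intros c Hc. apply HG, Hc. }
  set (z := fun c => if c <? n then nth c zs [] else []).
  assert (Ez : forall c, nth c (chans (s j)) [] = nth c (chans (s i)) [] ++ z c).
  { intros c. unfold z. destruct (Nat.ltb_spec c n) as [Hc|Hc]; [now apply Hzs|].
    destruct Si as [Li _], Sj as [Lj _]. now rewrite !nth_overflow by congruence. }
  (* The second round of the loop need not occur in the given run; commutation lets the surplus pass
     through the first round unchanged and thereby produces it. *)
  destruct (trun_append I m WF (s i) ts (s j) (s j) z z) as (s2 & R3 & F1 & F2 & F3); auto.
  { intros c. unfold z. destruct (Nat.ltb_spec c n) as [Hc|Hc]; [now apply Hzs|].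
    now rewrite app_nil_r. }
  pose proof (trun_shape I m WF _ _ _ Sj R3) as S2.
  destruct (trun_run I m _ (trun_transitions I m _ _ _ R1)) as [k1 K1].
  destruct (trun_run I m _ (trun_transitions I m _ _ _ R2)) as [k2 K2].
  destruct (Hlive i) as [us Hus].
  assert (Ezip : forall a b, shape a -> shape b ->
    (forall c, nth c (chans b) [] = nth c (chans a) [] ++ z c) ->
    chans b = zip_app (chans a) zs).
  { intros a b [La _] [Lb _] E. apply nth_ext with (d := []) (d' := []).
    - unfold zip_app. rewrite length_map, length_seq. congruence.
    - intros c Hc. rewrite (zip_app_chans I _ _ c La), E. unfold z.
      destruct (Nat.ltb_spec c n); auto. lia. }
  exists (k1, (k2, (zs, us))). unfold pump_cert. cbn [fst snd].
  apply existsb_exists. exists (s i). split; [rewrite <- H0; now apply K1|].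
  apply existsb_exists. exists (s j). split; [now apply K2|].
  apply existsb_exists. exists s2. split; [now apply K2|].
  rewrite (proj2 (Nat.eqb_eq _ _) Ectl).
  rewrite (proj2 (eqe_spec _ _ injective_words) Esets).
  rewrite (proj2 (eqe_spec _ _ injective_words) (Ezip _ _ Si Sj Ez)).
  rewrite (proj2 (eqe_spec _ _ injective_words) (Ezip _ _ Sj S2 F3)).
  destruct (eqe (s i) (s j)) eqn:E.
  { apply (eqe_spec _ _ injective_state) in E. exfalso. now apply (Hinj i j). }
  simpl. unfold accepting, channels. rewrite (length_langs I WF).
  apply forallb_forall. intros c Hc. apply in_seq in Hc. apply Hus. lia.
Qed.
End Run.

(** For the exact [F] of coreachable states, [alive] implies [live]. If no finite set of states is a
    certificate with this [F], the escaping run stays among live states and contains a pumpable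
    loop. *)
Lemma certificates_complete :
  (exists C, pump_cert m J C = true) \/ (exists C, finite_cert m J C = true).
Proof.
  destruct coreachable_sets as (F & HF & HL).
  destruct (classic (exists S, finite_cert m J (S, F) = true)) as [[S HS]|No]; [eauto|].
  left.
  destruct (escaping_run F (start J)) as (s & t & E0 & Hst & Ha & Hinj).
  { apply no_cert_escapes; auto. intros S.
    destruct (finite_cert m J (S, F)) eqn:E; auto. exfalso. eauto. }
  apply (run_pump_cert s t); auto. intros i.
  destruct (Hst i) as [Ht Hf].
  (* Only successors are known to be alive; [s i], including the start, inherits liveness from
     [s (S i)]. *)
  apply (trun_live I m WF (s i) [t i] (s (S i))).
  - now apply (run_shape s t).
  - econstructor; eauto. constructor.
  - apply HL, Ha.
Qed.
End Completeness.

Theorem theorem6p4 :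
  decidable_on enc_instance wf_instance OB_unbounded /\
  decidable_on enc_instance wf_instance OB_terminating.
Proof.
  split.
  - apply (decidable_of_certificates enc_instance conv _ _ (pump_cert 0) (finite_cert 0)).
    + apply enc_conv.
    + auto 10 using surjective_prod, surjective_list, surjective_nat.
    + auto 10 using surjective_prod, surjective_list, surjective_nat.
    + apply cmp_pump_cert.
    + apply cmp_finite_cert.
    + intros I C W. now apply (pump_cert_unbounded I 0).
    + intros I C W. now apply (finite_cert_bounded I 0).
    + intros I W. now apply certificates_complete.
  (* Termination is the finite side, so the two kinds of certificates exchange their roles. *)
  - apply (decidable_of_certificates enc_instance conv _ _ (finite_cert 1) (pump_cert 1)).
    + apply enc_conv.
    + auto 10 using surjective_prod, surjective_list, surjective_nat.
    + auto 10 using surjective_prod, surjective_list, surjective_nat.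
    + apply cmp_finite_cert.
    + apply cmp_pump_cert.
    + intros I C W. now apply (finite_cert_terminating I 1).
    + intros I C W. now apply (pump_cert_nonterminating I 1).
    + intros I W. destruct (certificates_complete I 1 W); auto.
Qed.
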